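(* Consider the bottleneck model with a transit outside option, with parameters $\Lambda,\lambda,\mu,e,L,z_C,z_T$ and desired crossing times uniform on $[t_1,t_2]$ (as described in the context). Suppose $\mu<\lambda$ and users choose between traveling by car through the bottleneck with free-flow cost $z_C$ and using public transit with fixed cost $z_T$, where $z_T \ge z_C$. Then the revenue-optimal dynamic tolling policy $\tau_d^*(\cdot)$, with car users crossing the bottleneck over the equilibrium interval $[t_A^*,t_D^*]$, where $t_A^*\le t_B^*\le t_C^*\le t_D^*$, is such that: 1. The toll is constant and equal to $\tau_d^*(t) = z_T - z_C$ for all $t\in[t_B^*,t_C^*]$. Moreover $\dfrac{t_C^*-t_B^*}{t_2-t_1} = f^*$, where $$f^* = \max\left\{ 1 - \frac{(z_T-z_C)\,\mu\,(e+L)}{\Lambda e L}\left(1-\frac{\mu}{\lambda}\right),\, 0\right\}.$$ 2. For all $t\in[t_A^*,t_B^*]$, $\tau_d^*(t) = z_T - z_C - e\,(t_B^*-t)$, and for all $t\in[t_C^*,t_D^*]$, $\tau_d^*(t) = z_T - z_C - L\,(t-t_C^* )$, where $t_B^*-t_A^* = \dfrac{L}{e+L}\,\dfrac{(1-f^* )\Lambda}{\mu}$ and $t_D^*-t_C^* = \dfrac{e}{e+L}\,\dfrac{(1-f^* )\Lambda}{\mu}$. Moreover, under this tolling policy, the optimal revenue (the maximum of $R(\tau(\cdot))$ over all dynamic tolling policies) is $$R^* = \begin{cases} (z_T-z_C)\Lambda\dfrac{\mu}{\lambda} + \dfrac{(z_T-z_C)^2\mu(e+L)}{2eL}\left(1-\dfrac{\mu}{\lambda}\right)^2,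 & \text{if } z_T-z_C \le \dfrac{\Lambda e L}{(\lambda-\mu)(e+L)}\dfrac{\lambda}{\mu},\\[2mm] (z_T-z_C)\Lambda - \dfrac{\Lambda^2}{2\mu}\dfrac{eL}{e+L}, & \text{if } z_T-z_C > \dfrac{\Lambda e L}{(\lambda-\mu)(e+L)}\dfrac{\lambda}{\mu}. \end{cases}$$
   Context: Bottleneck model with outside option. A continuum of users of total mass $\Lambda>0$ has desired bottleneck crossing times $t^*$ uniformly distributed over $[t_1,t_2]$, with desired arrival rate $\lambda = \Lambda/(t_2-t_1)$. Each user travels either by car, through a deterministic first-in-first-out point-queue bottleneck with capacity (maximal service rate) $\mu>0$, or by public transit. All costs are normalized by the value of waiting time. A car user with desired crossing time $t^*$ who crosses the bottleneck at time $t$ pays $$c(t,t^* ) = z_C + w(t) + e\,(t^*-t)_+ + L\,(t-t^* )_+ + \tau(t),$$ where $z_C$ is the free-flow cost of a car trip, $w(t)\ge 0$ is the (endogenous) queuing delay of a vehicle crossing at time $t$ ($w(t)>0$ only when the bottleneck discharges at capacity), $0<e<1$ and $L>0$ are the earliness and lateness penalties, and $\tau(t)\ge 0$ is the toll for crossing at time $t$. A transit user pays the fixed cost $z_T$ and arrives at the desired time. A dynamic tolling policy is a (possibly time-varying) toll function $\tau(\cdot)$. Equilibrium: given the toll, every user chooses a mode and, if traveling by car, a crossing time, so as to minimize own cost given $w(\cdot)$, and no user has an incentive to deviate; car users cross in order of their desired crossing times. When users are indifferent between car and transit, ties are broken in favor of higher-revenue outcomes. When $z_T \ge z_C$ and $\mu<\lambda$,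 car users cross at rate $\mu$ over an equilibrium interval $[t_A,t_D]$ (depending on the policy); the toll only matters for revenue on this interval. Revenue: $R(\tau(\cdot))$ is the total toll paid by car users at the equilibrium induced by the policy; for $z_T\ge z_C$ and $\mu<\lambda$, $R(\tau(\cdot)) = \int_{t_A}^{t_D}\mu\,\tau(t)\,dt$. A dynamic policy is revenue-optimal if it maximizes $R$ over all dynamic tolling policies. *)

(* Defs.v *)
From HB Require Import structures.
From mathcomp Require Import all_boot all_order all_algebra.
From mathcomp Require Import all_classical all_reals all_analysis.

Set Implicit Arguments.
Unset Strict Implicit.
Unset Printing Implicit Defensive.

Import Order.TTheory GRing.Theory Num.Theory.
Import numFieldNormedType.Exports.

Local Open Scope classical_set_scope.
Local Open Scope ring_scope.

(* Bottleneck model with an outside option; all costs are in units of waiting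
   time. *)
Record bottleneck (R : realType) := Bottleneck {
  mass : R;          (* Lambda, total mass of users *)
  capacity : R;      (* mu *)
  early : R;         (* e *)
  late : R;          (* L *)
  zC : R;            (* free-flow cost of a car trip *)
  zT : R;            (* cost of a transit trip *)
  t1 : R;            (* desired crossing times are uniform on [t1, t2] *)
  t2 : R
}.

Definition arrival_rate (R : realType) (m : bottleneck R) : R :=
  mass m / (t2 m - t1 m).

(* A user is identified with a desired crossing time s in [t1, t2]; users have
   density [arrival_rate m].  Among the users with desired time s, the fraction
   [share s] drives and crosses at time [cross s], the others take transit
   ([cross s] is meaningless when [share s = 0]).  Allowing several crossing
   times for one s would change nothing, a single s having mass 0.
   [delay t] is the queuing delay w(t) of a vehicle crossing at time t. *)
Record profile (R : realType) := Profile {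
  share : R -> R;
  cross : R -> R;
  delay : R -> R
}.

Definition car_user (R : realType) (m : bottleneck R) (E : profile R) (s : R) :
  Prop := t1 m <= s <= t2 m /\ 0 < share E s.

Definition car_flow (R : realType) (m : bottleneck R) (E : profile R)
    (B : set R) : \bar R :=
  (\int[lebesgue_measure]_(s in `[t1 m, t2 m] `&` (cross E @^-1` B))
      (arrival_rate m * share E s)%:E)%E.

Definition car_cost (R : realType) (m : bottleneck R) (toll w : R -> R)
    (t s : R) : R :=
  zC m + w t + early m * Num.max (s - t) 0 + late m * Num.max (t - s) 0
    + toll t.

(* The vehicle crossing at t reached the bottleneck at t - w(t), so
   first-in-first-out service means that t - w(t) is nondecreasing.  A vehicle
   that waits does so behind a queue discharged at capacity from its arrival to
   its crossing. *)
Definition point_queue (R : realType) (m : bottleneck R) (E : profile R) :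
  Prop :=
  [/\ forall t t', t <= t' ->
        (car_flow m E `[t, t'] <= (capacity m * (t' - t))%:E)%E,
      forall t, 0 <= delay E t,
      forall t t', t <= t' -> t - delay E t <= t' - delay E t' &
      forall t, 0 < delay E t ->
        car_flow m E `[t - delay E t, t] = (capacity m * delay E t)%:E].

Definition feasible (R : realType) (m : bottleneck R) (E : profile R) : Prop :=
  [/\ measurable_fun `[t1 m, t2 m] (share E)
        /\ measurable_fun `[t1 m, t2 m] (cross E),
      forall s, t1 m <= s <= t2 m -> 0 <= share E s <= 1,
      forall s s', car_user m E s -> car_user m E s' -> s <= s' ->
        cross E s <= cross E s' &
      point_queue m E].

Definition equilibrium (R : realType) (m : bottleneck R) (toll : R -> R)
    (E : profile R) : Prop :=
  [/\ feasible m E,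
      forall s, car_user m E s ->
        car_cost m toll (delay E) (cross E s) s <= zT m
        /\ forall t, car_cost m toll (delay E) (cross E s) s
                     <= car_cost m toll (delay E) t s &
      forall s, t1 m <= s <= t2 m -> share E s < 1 ->
        forall t, zT m <= car_cost m toll (delay E) t s].

Definition policy (R : realType) (toll : R -> R) : Prop :=
  measurable_fun [set: R] toll /\ forall t, 0 <= toll t.

Definition collected (R : realType) (m : bottleneck R) (toll : R -> R)
    (E : profile R) : \bar R :=
  (\int[lebesgue_measure]_(s in `[t1 m, t2 m])
      (arrival_rate m * share E s * toll (cross E s))%:E)%E.

(* The supremum over the equilibria of a policy implements the tie-breaking in
   favor of higher revenue; a policy without equilibrium has revenue -oo. *)
Definition revenue (R : realType) (m : bottleneck R) (toll : R -> R) : \bar R :=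
  ereal_sup [set collected m toll E | E in [set E | equilibrium m toll E]].

Definition induced_equilibrium (R : realType) (m : bottleneck R)
    (toll : R -> R) (E : profile R) : Prop :=
  equilibrium m toll E /\ collected m toll E = revenue m toll.

Definition revenue_optimal (R : realType) (m : bottleneck R) (toll : R -> R) :
  Prop :=
  policy toll
  /\ forall toll', policy toll' -> (revenue m toll' <= revenue m toll)%E.

Definition crosses_over (R : realType) (m : bottleneck R) (E : profile R)
    (tA tD : R) : Prop :=
  (forall t t', tA <= t -> t <= t' -> t' <= tD ->
     car_flow m E `[t, t'] = (capacity m * (t' - t))%:E)
  /\ car_flow m E (~` `[tA, tD]) = 0%E.

Definition fstar (R : realType) (m : bottleneck R) : R :=
  Num.max
    (1 - (zT m - zC m) * capacity m * (early m + late m)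
           / (mass m * early m * late m)
         * (1 - capacity m / arrival_rate m))
    0.

(* The shape of the toll is required at the times in D. *)
Definition optimal_shape (R : realType) (m : bottleneck R) (D : set R)
    (toll : R -> R) (tA tB tC tD : R) : Prop :=
  [/\ tA <= tB, tB <= tC & tC <= tD]
  /\ [/\ forall t, D t -> tB <= t <= tC -> toll t = zT m - zC m,
         (tC - tB) / (t2 m - t1 m) = fstar m,
         forall t, D t -> tA <= t <= tB ->
           toll t = zT m - zC m - early m * (tB - t),
         forall t, D t -> tC <= t <= tD ->
           toll t = zT m - zC m - late m * (t - tC) &
         tB - tA = late m / (early m + late m)
                     * ((1 - fstar m) * mass m / capacity m)
         /\ tD - tC = early m / (early m + late m)
                        * ((1 - fstar m) * mass m / capacity m)].

Definition optimal_revenue (R : realType) (m : bottleneck R) : R :=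
  let gap := zT m - zC m in
  let lam := arrival_rate m in
  let mu := capacity m in
  let e := early m in
  let L := late m in
  if gap <= mass m * e * L / ((lam - mu) * (e + L)) * (lam / mu)
  then gap * mass m * (mu / lam)
       + gap ^+ 2 * mu * (e + L) / (2 * e * L) * (1 - mu / lam) ^+ 2
  else gap * mass m - mass m ^+ 2 / (2 * mu) * (e * L / (e + L)).

(* Main.v *)
(* Write V(t) = zT - zC - w(t) - toll(t) for what crossing at t is worth, so that
   a user with desired time s obtains at best U(s) = sup_t (V(t) - d(t, s)),
   where d is the early or late penalty.  U is Lipschitz; let u be its minimum
   (or 0 if that is negative) and b <= c the extreme points of {U <= u}.  Users
   outside [b, c] strictly gain and all drive.  As lambda > mu, those before b
   have to cross well before their desired times, and comparing a user with the
   one whose crossing time is at most that user's desired time, again and again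
   until b is reached, forces V(t) = u + e (b - t) at their crossing times;
   symmetrically after c.  Users inside ]b, c[ can only cross in [b, c] and pay
   at most zT - zC - u.  Hence the revenue is at most an explicit quadratic in
   (b, c), maximal exactly for u = 0 and the announced lengths.  Conversely the
   announced toll reaches the bound, and equality in the bound fixes the toll
   at the crossing times. *)
Require Import Defs.
From HB Require Import structures.
From mathcomp Require Import all_boot all_order all_algebra.
From mathcomp Require Import all_classical all_reals all_analysis.
From mathcomp Require Import measurable_realfun ring lra.
Set Implicit Arguments.
Unset Strict Implicit.
Unset Printing Implicit Defensive.

Import Order.TTheory GRing.Theory Num.Theory.
Import numFieldNormedType.Exports.
Local Open Scope classical_set_scope.
Local Open Scope ring_scope.

(** * Utilities of the users *)

Section Utility.
Variables (R : realType) (m : bottleneck R).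
Hypotheses (early_gt0 : 0 < early m) (late_gt0 : 0 < late m).

Definition deviation (t s : R) : R :=
  early m * Num.max (s - t) 0 + late m * Num.max (t - s) 0.

Definition surplus (toll w : R -> R) (t : R) : R :=
  zT m - zC m - w t - toll t.

(** [sup] is a genuine supremum only for a nonempty set bounded above; [utility_has_sup] secures
    this, since nonnegative tolls and delays keep the surplus below [zT m - zC m]. *)
Definition utility (toll w : R -> R) (s : R) : R :=
  sup [set surplus toll w t - deviation t s | t in [set: R]].

Lemma car_costE (toll w : R -> R) t s :
  car_cost m toll w t s = zT m - (surplus toll w t - deviation t s).
Proof. by rewrite /car_cost /surplus /deviation; ring. Qed.

Lemma deviation_early t s : t <= s -> deviation t s = early m * (s - t).
Proof.
by move=> ts; rewrite /deviation max_l ?max_r ?mulr0 ?addr0 ?subr_ge0 ?subr_le0.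
Qed.

Lemma deviation_late t s : s <= t -> deviation t s = late m * (t - s).
Proof.
by move=> st; rewrite /deviation max_r ?max_l ?mulr0 ?add0r ?subr_ge0 ?subr_le0.
Qed.

Lemma deviation_ge0 t s : 0 <= deviation t s.
Proof.
rewrite /deviation addr_ge0// mulr_ge0 ?(ltW early_gt0) ?(ltW late_gt0)//;
  by rewrite le_max lexx orbT.
Qed.

(** Each penalty is Lipschitz with its own slope. The constant does not depend on [t], so it
    survives the supremum that defines [utility]. *)
Lemma deviation_lipschitz t s s' :
  deviation t s <= deviation t s' + (early m + late m) * `|s - s'|.
Proof.
have early_le : early m * Num.max (s - t) 0
    <= early m * Num.max (s' - t) 0 + early m * `|s - s'|.
  rewrite -mulrDr ler_pM2l// ge_max addr_ge0 ?andbT ?le_max ?lexx ?orbT//.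
  have := ler_norm (s - s'); have : s' - t <= Num.max (s' - t) 0.
    by rewrite le_max lexx.
  lra.
have late_le : late m * Num.max (t - s) 0
    <= late m * Num.max (t - s') 0 + late m * `|s - s'|.
  rewrite -mulrDr ler_pM2l// ge_max addr_ge0 ?andbT ?le_max ?lexx ?orbT//.
  have := ler_norm (s' - s); have : t - s' <= Num.max (t - s') 0.
    by rewrite le_max lexx.
  by rewrite distrC; lra.
by rewrite /deviation; lra.
Qed.

Section Equilibrium.
Variables (toll : R -> R) (E : profile R).
Hypotheses (toll_policy : policy toll) (eqE : equilibrium m toll E).
Local Notation V := (surplus toll (delay E)).
Local Notation U := (utility toll (delay E)).

Lemma equilibrium_delay_ge0 t : 0 <= delay E t.
Proof. by case: eqE => -[_ _ _ [_ + _ _]] _ _; exact. Qed.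

Lemma surplus_le_gap t : V t <= zT m - zC m.
Proof.
have := equilibrium_delay_ge0 t; have [_ /(_ t)] := toll_policy.
by rewrite /surplus; lra.
Qed.

Let utility_has_sup s :
  has_sup [set V t - deviation t s | t in [set: R]].
Proof.
split; first by exists (V 0 - deviation 0 s); exists 0.
exists (zT m - zC m) => _ [t _ <-].
by have := surplus_le_gap t; have := deviation_ge0 t s; lra.
Qed.

Lemma utility_ge t s : V t - deviation t s <= U s.
Proof. by apply: sup_upper_bound => //; exists t. Qed.

Lemma utility_le x s : (forall t, V t - deviation t s <= x) -> U s <= x.
Proof.
move=> Vx; apply: ge_sup; first by exists (V 0 - deviation 0 s); exists 0.
by move=> _ [t _ <-].
Qed.

Lemma utility_le_gap s : U s <= zT m - zC m.
Proof.
apply: utility_le => t.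
by have := surplus_le_gap t; have := deviation_ge0 t s; lra.
Qed.

Lemma utility_lipschitz s s' : U s <= U s' + (early m + late m) * `|s - s'|.
Proof.
apply: utility_le => t; have := utility_ge t s'.
by have := deviation_lipschitz t s' s; rewrite distrC; lra.
Qed.

Lemma utility_continuous : continuous U.
Proof.
have K0 : 0 < early m + late m by rewrite addr_gt0.
move=> s; apply/cvgrPdist_le => e e0; near=> s'.
have : `|s - s'| <= e / (early m + late m).
  near: s'; apply/nbhs_ballP; exists (e / (early m + late m)) => /=.
    by rewrite divr_gt0.
  by move=> s'' /ltW.
rewrite ler_pdivlMr// mulrC => se.
have := utility_lipschitz s s'; have := utility_lipschitz s' s.
by rewrite [`|s' - s|]distrC ler_norml; lra.
Unshelve. all: by end_near. Qed.

Lemma car_user_utility s : car_user m E s ->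
  U s = V (cross E s) - deviation (cross E s) s /\ 0 <= U s.
Proof.
case: eqE => _ best _ /best[cheap opt].
have UE : U s = V (cross E s) - deviation (cross E s) s.
  apply/le_anti; rewrite utility_ge andbT; apply: utility_le => t.
  by have := opt t; rewrite !car_costE; lra.
by split=> //; rewrite UE; move: cheap; rewrite car_costE; lra.
Qed.

Lemma utility_gt0_share s : t1 m <= s <= t2 m -> 0 < U s -> share E s = 1.
Proof.
case: eqE => -[_ + _ _] _ stay sI Us => /(_ _ sI)/andP[_].
rewrite le_eqVlt => /orP[/eqP//|share_lt1].
have : U s <= 0.
  by apply: utility_le => t; have := stay _ sI share_lt1 t; rewrite car_costE; lra.
by lra.
Qed.

(* [b] and [c] are the extreme users whose utility does not exceed the minimal
   utility [u] of the drivers. *)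
Definition marginal_users (u b c : R) : Prop :=
  [/\ t1 m <= b, b <= c, c <= t2 m, 0 <= u & u <= zT m - zC m] /\
  [/\ forall t, V t <= u + deviation t b,
      forall t, V t <= u + deviation t c,
      forall s, t1 m <= s -> s < b -> share E s = 1,
      forall s, c < s -> s <= t2 m -> share E s = 1 &
      forall s, car_user m E s -> u + deviation (cross E s) s <= V (cross E s)].

(** [b] and [c] are the infimum and the supremum of a sublevel set of [U], which is nonempty because
    it contains a minimizer over the compact [[t1, t2]]. *)
Lemma exists_marginal_users : t1 m <= t2 m -> 0 <= zT m - zC m ->
  exists u b c, marginal_users u b c.
Proof.
move=> t12 gap0.
have Ucont : {within `[t1 m, t2 m], continuous U}.
  exact/continuous_subspaceT/utility_continuous.
have [s0 s0I Umin] := EVT_min t12 Ucont.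
(* Drivers have nonnegative utility, so truncating the minimum at 0 keeps [u] below the utility of
   every driver, and [U s > u] then rules out transit for [s]. *)
pose u := Num.max (U s0) 0.
pose Z := [set s | s \in `[t1 m, t2 m] /\ U s <= u].
have Z0 : Z s0 by split => //; rewrite /u le_max lexx.
have Zsup : has_sup Z.
  by split; [exists s0 | exists (t2 m) => s -[]; rewrite in_itv/= => /andP[]].
have Zinf : has_inf Z.
  by split; [exists s0 | exists (t1 m) => s -[]; rewrite in_itv/= => /andP[]].
have Zle s : Z s -> s <= sup Z by exact: sup_upper_bound.
have Zge s : Z s -> inf Z <= s by apply: ge_inf; case: Zinf.
have K0 : 0 < early m + late m by rewrite addr_gt0.
(* The sublevel set is closed, by the Lipschitz bound; hence [U] is at most [u] at its infimum and
   its supremum. *)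
have near_le s : (forall e, 0 < e -> exists2 z, Z z & `|s - z| < e) -> U s <= u.
  move=> near_s; apply/ler_addgt0Pr => e e0.
  have [|z [_ Uz] sz] := near_s (e / (early m + late m)); first by rewrite divr_gt0.
  have := utility_lipschitz s z; move: sz; rewrite ltr_pdivlMr// mulrC.
  by lra.
have UB : U (inf Z) <= u.
  apply: near_le => e e0; have [z Zz ze] := inf_adherent e0 Zinf.
  by exists z => //; rewrite distrC ger0_norm ?subr_ge0 ?Zge//; lra.
have UC : U (sup Z) <= u.
  apply: near_le => e e0; have [z Zz ze] := sup_adherent e0 Zsup.
  by exists z => //; rewrite ger0_norm ?subr_ge0 ?Zle//; lra.
have u0 : 0 <= u by rewrite /u le_max lexx orbT.
have b1 : t1 m <= inf Z.
  by apply: lb_le_inf; [exists s0 | move=> s -[]; rewrite in_itv/= => /andP[]].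
have c2 : sup Z <= t2 m.
  by apply: ge_sup; [exists s0 | move=> s -[]; rewrite in_itv/= => /andP[]].
have outside s : t1 m <= s <= t2 m -> ~ Z s -> share E s = 1.
  move=> sI nZ; apply: utility_gt0_share => //; rewrite ltNge; apply/negP => Us.
  by apply: nZ; split; rewrite ?in_itv//=; lra.
exists u, (inf Z), (sup Z); split; split => //.
- exact: le_trans (Zge _ Z0) (Zle _ Z0).
- by rewrite /u ge_max gap0 andbT; exact: utility_le_gap.
- by move=> t; have := utility_ge t (inf Z); lra.
- by move=> t; have := utility_ge t (sup Z); lra.
- move=> s s1 sB; apply: outside => [|/Zge]; last by move=> ?; lra.
  have := le_trans (Zge _ Z0) (Zle _ Z0).
  by move: sB c2 s1; lra.
- move=> s sC s2; apply: outside => [|/Zle]; last by move=> ?; lra.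
  have := le_trans (Zge _ Z0) (Zle _ Z0).
  by move: sC b1 s2; lra.
- move=> s cs; have [UE Us] := car_user_utility cs.
  suff : u <= U s by rewrite UE; lra.
  rewrite /u ge_max Us andbT; apply: Umin; rewrite in_itv/=.
  by case: cs.
Qed.

End Equilibrium.

End Utility.

(** * Auxiliary analysis *)

(* Iterating [x |-> r * x] drives [e * x] to 0. *)
Lemma le_of_contraction (R : realType) (p : R -> R) (r e K X : R) :
  0 < r < 1 -> 0 <= e ->
  (forall x : R, 0 < x <= X -> p (r * x) <= p x) ->
  (forall x : R, 0 < x <= X -> K - e * x <= p x) ->
  forall x : R, 0 < x <= X -> K <= p x.
Proof.
move=> /andP[r0 r1] e0 pr Kp x /andP[x0 xX].
have rn n : K - e * (r ^+ n * x) <= p x.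
  elim: n x x0 xX => [|n IH] x x0 xX; first by rewrite expr0 mul1r Kp ?x0.
  have rx : 0 < r * x <= X.
    rewrite mulr_gt0//= (le_trans _ xX)// ler_piMl ?ltW//.
  case/andP: (rx) => rx0 rxX; rewrite exprSr -mulrA.
  by rewrite (le_trans (IH _ rx0 rxX))// pr// x0.
have lim0 : (fun n => K - e * (r ^+ n * x)) @ \oo --> K - e * (0 * x).
  apply: cvgB; first exact: cvg_cst.
  apply: cvgM; first exact: cvg_cst.
  apply: cvgM; last exact: cvg_cst.
  by apply: cvg_expr; rewrite ger0_norm ?ltW.
rewrite mul0r mulr0 subr0 in lim0.
by apply: cvgr_to_le lim0 _; near=> n.
Unshelve. all: by end_near. Qed.

Lemma integral_affine (R : realType) (p q a b : R) : a <= b ->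
  (\int[lebesgue_measure]_(s in `[a, b]) (p + q * s)%:E =
   (p * (b - a) + q / 2 * (b ^+ 2 - a ^+ 2))%:E)%E.
Proof.
rewrite le_eqVlt => /orP[/eqP->|ab].
  by rewrite set_itv1 integral_set1 !subrr !mulr0 addr0.
pose F s := p * s + q / 2 * s ^+ 2.
have dF (s : R) : is_derive s 1 F (p + q * s).
  by rewrite /F; apply: is_derive_eq; rewrite /GRing.scale /=; field.
have cF : continuous F.
  by move=> s; apply/differentiable_continuous/derivable1_diffP; have [] := dF s.
rewrite (@continuous_FTC2 _ _ F)//.
- by rewrite -EFinB /F; congr EFin; ring.
- apply: continuous_subspaceT => s; apply: cvgD; first exact: cvg_cst.
  by apply: cvgM; [exact: cvg_cst | exact: cvg_id].
- split; first by move=> s _; have [] := dF s.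
    by apply: cvg_at_right_filter; exact: cF.
  by apply: cvg_at_left_filter; exact: cF.
- by move=> s _; rewrite derive1E; exact: derive_val.
Qed.

Lemma ge0_integral_split3 (R : realType) (a b c d : R) (f : R -> R) :
  a <= b -> b <= c -> c <= d ->
  measurable_fun `[a, d] f -> (forall s, a <= s <= d -> 0 <= f s) ->
  (\int[lebesgue_measure]_(s in `[a, d]) (f s)%:E =
   \int[lebesgue_measure]_(s in `[a, b[) (f s)%:E
   + \int[lebesgue_measure]_(s in `[b, c]) (f s)%:E
   + \int[lebesgue_measure]_(s in `]c, d]) (f s)%:E)%E.
Proof.
move=> ab bc cd mf f0.
have sub (A : set R) : A `<=` `[a, d] ->
    measurable_fun A (fun s => (f s)%:E).
  by move=> Aad; apply/measurable_EFinP; exact: measurable_funS mf.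
have ac : `[a, c]%classic = `[a, b[ `|` `[b, c].
  by rewrite -itv_bndbnd_setU ?bnd_simp.
have adE : `[a, d]%classic = `[a, c] `|` `]c, d].
  by rewrite -itv_bndbnd_setU ?bnd_simp// (le_trans ab).
have acd : `[a, c] `<=` `[a, d].
  by move=> x /=; rewrite !in_itv/=; lra.
rewrite {1}adE ge0_integral_setU//; last 3 first.
- by rewrite -adE; exact: sub.
- by move=> x; rewrite -adE/= in_itv/= lee_fin; exact: f0.
- by apply/disj_setPLR => x /=; rewrite !in_itv/=; lra.
congr (_ + _)%E; rewrite ac ge0_integral_setU//.
- by rewrite -ac; exact: sub.
- by move=> x; rewrite -ac => /acd/=; rewrite in_itv/= lee_fin; exact: f0.
- by apply/disj_setPLR => x /=; rewrite !in_itv/=; lra.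
Qed.

(** The nonnegative difference [g - f] has integral 0; finiteness is what allows the subtraction of
    the integrals. *)
Lemma ae_eq_of_integral_eq d (T : measurableType d) (R : realType)
    (mu : {measure set T -> \bar R}) (D : set T) (f g : T -> R) :
  measurable D -> measurable_fun D f -> measurable_fun D g ->
  (forall x, D x -> 0 <= f x <= g x) ->
  (\int[mu]_(x in D) (g x)%:E < +oo)%E ->
  (\int[mu]_(x in D) (f x)%:E = \int[mu]_(x in D) (g x)%:E)%E ->
  {ae mu, forall x, D x -> f x = g x}.
Proof.
move=> mD mf mg fg goo fgE.
have mgf : measurable_fun D (fun x => (g x - f x)%:E).
  by apply/measurable_EFinP; exact: measurable_funB.
have : ae_eq mu D (fun x => (g x - f x)%:E) (cst 0%:E).
  apply/(ae_eq_integral_abs mu mD mgf).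
  have -> : (\int[mu]_(x in D) `|(g x - f x)%:E| =
             \int[mu]_(x in D) (g x - f x)%:E)%E.
    apply: eq_integral => x; rewrite inE => /fg/andP[_ le_fg].
    by rewrite abse_EFin ger0_norm ?subr_ge0.
  have fin : (\int[mu]_(x in D) (f x)%:E)%E \is a fin_num.
    rewrite fgE ge0_fin_numE//; apply: integral_ge0 => x /fg/andP[f0 le_fg].
    by rewrite lee_fin (le_trans f0).
  have : (\int[mu]_(x in D) (g x)%:E =
      \int[mu]_(x in D) (f x)%:E + \int[mu]_(x in D) (g x - f x)%:E)%E.
    rewrite -ge0_integralD//.
    - by apply: eq_integral => x _; rewrite -EFinD; congr EFin; ring.
    - by move=> x /fg/andP[]; rewrite lee_fin.
    - exact/measurable_EFinP.
    - by move=> x /fg/andP[_]; rewrite lee_fin subr_ge0.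
  move=> /(congr1 (fun z => z - \int[mu]_(x in D) (f x)%:E)%E).
  by rewrite -fgE subee// [X in (X - _)%E]addeC addeK.
apply: filterS => x /[apply] -[]; lra.
Qed.

Lemma lebesgue_aeS (R : realType) (P Q : R -> Prop) : (forall x, P x -> Q x) ->
  {ae lebesgue_measure, forall x, P x} -> {ae lebesgue_measure, forall x, Q x}.
Proof.
move=> PQ; exact: (@filterS _ _ (@ae_filter_ringOfSetsType _ _ _ _)).
Qed.

(** * Crossing times and tolls in equilibrium *)

Section Model.
Variables (R : realType) (m : bottleneck R).
Hypotheses (t1_lt_t2 : t1 m < t2 m)
  (capacity_gt0 : 0 < capacity m)
  (early_gt0 : 0 < early m) (late_gt0 : 0 < late m)
  (congested : capacity m < arrival_rate m) (zC_le_zT : zC m <= zT m).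
Local Notation lam := (arrival_rate m).
Local Notation mu := (capacity m).
Local Notation gap := (zT m - zC m).

(** For [s < b], the [lam * (b - s)] users between [s] and [b], served at rate [mu] up to time [b],
    start crossing at this time; the case [s > c] is symmetric, and users in between cross on
    time. *)
Definition planned_cross (b c s : R) : R :=
  s - (lam / mu - 1) * Num.max (b - s) 0 + (lam / mu - 1) * Num.max (s - c) 0.

(** With [p] the gap this is the announced toll, extended to all times without truncation, so
    possibly negative; with [p] the gap minus [u] it bounds the tolls paid in an arbitrary
    equilibrium. *)
Definition peak_toll (p b c t : R) : R :=
  p - early m * Num.max (b - t) 0 - late m * Num.max (t - c) 0.

Lemma planned_cross_early b c s : s <= b -> b <= c ->
  planned_cross b c s = b - lam / mu * (b - s).
Proof.
move=> sb bc; rewrite /planned_cross max_l ?subr_ge0// max_r; first by ring.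
by rewrite subr_le0 (le_trans sb).
Qed.

Lemma planned_cross_mid b c s : b <= s <= c -> planned_cross b c s = s.
Proof.
move=> /andP[bs sc]; rewrite /planned_cross !max_r ?subr_le0//.
by rewrite !mulr0 subr0 addr0.
Qed.

Lemma planned_cross_late b c s : b <= c -> c <= s ->
  planned_cross b c s = c + lam / mu * (s - c).
Proof.
move=> bc cs; rewrite /planned_cross max_r ?max_l ?subr_ge0//; first by ring.
by rewrite subr_le0 (le_trans bc).
Qed.

Lemma peak_toll_early p b c t : t <= b -> b <= c ->
  peak_toll p b c t = p - early m * (b - t).
Proof.
move=> tb bc; rewrite /peak_toll max_l ?subr_ge0// max_r ?mulr0 ?subr0//.
by rewrite subr_le0 (le_trans tb).
Qed.

Lemma peak_toll_mid p b c t : b <= t <= c -> peak_toll p b c t = p.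
Proof.
move=> /andP[bt tc]; rewrite /peak_toll !max_r ?subr_le0//.
by rewrite !mulr0 !subr0.
Qed.

Lemma peak_toll_late p b c t : b <= c -> c <= t ->
  peak_toll p b c t = p - late m * (t - c).
Proof.
move=> bc ct; rewrite /peak_toll max_r ?max_l ?subr_ge0 ?mulr0 ?subr0//.
by rewrite subr_le0 (le_trans bc).
Qed.

Lemma measurable_car_mass E : feasible m E ->
  measurable_fun `[t1 m, t2 m] (fun s => lam * share E s).
Proof. by case=> -[mshare _] _ _ _; exact: measurable_funM. Qed.

Lemma lam_gt0 : 0 < lam. Proof. exact: lt_trans congested. Qed.

Lemma car_mass_ge0 E s : feasible m E -> t1 m <= s <= t2 m ->
  0 <= lam * share E s.
Proof.
by case=> _ share01 _ _ /share01/andP[? _]; rewrite mulr_ge0 ?(ltW lam_gt0).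
Qed.

(** [car_flow] integrates over a preimage of [cross E], whose values mean nothing where the share is
    0. So [A] is split along that preimage: outside it the share vanishes and nothing is lost. *)
Lemma car_mass_le_car_flow E (A B : set R) : feasible m E ->
  measurable A -> measurable B -> A `<=` `[t1 m, t2 m] ->
  (forall s, A s -> 0 < share E s -> B (cross E s)) ->
  (\int[lebesgue_measure]_(s in A) (lam * share E s)%:E <= car_flow m E B)%E.
Proof.
move=> fE mA mB AI AB; case: (fE) => -[mshare mcross] share01 _ _.
have mI : measurable (`[t1 m, t2 m] : set R) by [].
have mC : measurable (`[t1 m, t2 m] `&` (cross E @^-1` B)) by exact: mcross.
set C := _ `&` _ in mC.
have mf (D : set R) : D `<=` `[t1 m, t2 m] ->
    measurable_fun D (fun s => (lam * share E s)%:E).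
  move=> DI; apply/measurable_EFinP.
  by apply: measurable_funS (measurable_car_mass fE).
have f0 (s : R) : `[t1 m, t2 m]%classic s -> (0 <= (lam * share E s)%:E)%E.
  by rewrite /= in_itv/= lee_fin => sI; exact: car_mass_ge0.
rewrite /car_flow -/C -[A](setUIDK A C).
rewrite ge0_integral_setU//; first last.
- by apply/disj_setPLR => x [_ Cx] [_].
- by move=> x [[Ax _]|[Ax _]]; exact/f0/AI.
- by apply: mf => x [[Ax _]|[Ax _]]; exact: AI.
- exact: measurableD.
- exact: measurableI.
rewrite [X in (_ + X)%E]integral0_eq ?adde0; last first.
  move=> s [As nCs]; have sI := AI _ As.
  have /andP[] : 0 <= share E s <= 1 by apply: share01; rewrite /= in_itv/= in sI.
  rewrite le_eqVlt => /orP[/eqP<- _|s0 _]; first by rewrite mulr0.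
  by exfalso; apply: nCs; split => //; exact: AB.
apply: ge0_subset_integral => //; first exact: measurableI.
- by apply: mf; exact: subIsetl.
- by move=> x [/f0].
Qed.

Lemma car_mass_le_capacity E (A : set R) t t' : feasible m E -> measurable A ->
  A `<=` `[t1 m, t2 m] -> t <= t' ->
  (forall s, A s -> 0 < share E s -> t <= cross E s <= t') ->
  (\int[lebesgue_measure]_(s in A) (lam * share E s)%:E
   <= (mu * (t' - t))%:E)%E.
Proof.
move=> fE mA AI tt' At; case: (fE) => _ _ _ [cap _ _ _].
by apply: le_trans (cap _ _ tt'); apply: car_mass_le_car_flow.
Qed.

Lemma integral_full_share E (i : interval R) :
  (forall s, [set` i] s -> share E s = 1) ->
  (\int[lebesgue_measure]_(s in [set` i]) (lam * share E s)%:E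
   = lam%:E * lebesgue_measure [set` i])%E.
Proof.
move=> share1; rewrite -integral_cst//; apply: eq_integral => s.
by rewrite inE => /share1 ->; rewrite mulr1.
Qed.

(** The kind of interval is left open because it is applied both to [[x, b[] and to []c, x]], on
    which everybody drives. *)
Lemma full_share_le_capacity E (i : interval R) a b t t' : feasible m E ->
  [set` i] `<=` `[t1 m, t2 m] -> t <= t' ->
  lebesgue_measure [set` i] = (b - a)%:E ->
  (forall s, [set` i] s -> share E s = 1 /\ t <= cross E s <= t') ->
  lam * (b - a) <= mu * (t' - t).
Proof.
move=> fE iI tt' lenE full.
rewrite -lee_fin EFinM -lenE -(@integral_full_share E); last by move=> s /full[].
by apply: car_mass_le_capacity => // s /full[].
Qed.

Lemma deviation_ge_early t s : early m * (s - t) <= deviation m t s.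
Proof.
by apply: ler_wpDr; rewrite ?mulr_ge0 ?ler_pM2l ?(ltW late_gt0)// le_max lexx ?orbT.
Qed.

Lemma deviation_ge_late t s : late m * (t - s) <= deviation m t s.
Proof.
by apply: ler_wpDl; rewrite ?mulr_ge0 ?ler_pM2l ?(ltW early_gt0)// le_max lexx ?orbT.
Qed.

Section Equilibrium.
Variables (toll : R -> R) (E : profile R) (u b c : R).
Hypotheses (toll_policy : policy toll) (eqE : equilibrium m toll E)
  (marginal : marginal_users m toll E u b c).
Local Notation V := (surplus m toll (delay E)).

Lemma best_cross s t : car_user m E s ->
  V t - deviation m t s <= V (cross E s) - deviation m (cross E s) s.
Proof.
case: eqE => _ best _ /best[_ /(_ t)]; rewrite !car_costE; lra.
Qed.

(* Iterating the comparison of [s] with the user [b - mu / lam * (b - s)], who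
   crosses before time [s] by the capacity bound, reaches [b]. *)
Lemma early_users s : t1 m <= s -> s < b ->
  V (cross E s) = u + early m * (b - cross E s) /\
  lam * (b - s) <= mu * (b - cross E s).
Proof.
case: (eqE) => fE _ _; case: (marginal) => -[t1b bc ct2 u0 ugap] [Vb Vc left _ drv].
have cu x : t1 m <= x -> x < b -> car_user m E x.
  by move=> x1 xb; split; rewrite ?(left x)// x1 (le_trans (ltW xb))// (le_trans bc).
(* A crossing after [b] would be worth at most [u] plus the late penalty counted from [b], yet the
   driver [x < b] requires [u] plus the larger penalty counted from [x]. *)
have le_b x : t1 m <= x -> x < b -> cross E x <= b.
  move=> x1 xb; rewrite leNgt; apply/negP => bx.
  have := Vb (cross E x); rewrite (deviation_late _ (ltW bx)).
  have := drv _ (cu _ x1 xb); have := deviation_ge_late (cross E x) x.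
  have : 0 < late m * (b - x) by rewrite mulr_gt0 ?subr_gt0.
  lra.
(* All users in [[x, b[] drive and, crossing in order of desired times, do so between [cross E x]
   and [b]. *)
have cap x : t1 m <= x -> x < b -> lam * (b - x) <= mu * (b - cross E x).
  move=> x1 xb; apply: (@full_share_le_capacity E `[x, b[) => //.
  - by move=> z /=; rewrite !in_itv/=; lra.
  - exact: le_b.
  - by rewrite lebesgue_measure_itv/= lte_fin xb EFinB.
  - move=> z /=; rewrite in_itv/= => /andP[xz zb].
    have z1 := le_trans x1 xz; split; first exact: left.
    rewrite le_b// andbT; case: fE => _ _ mono _.
    by apply: mono => //; exact: cu.
move=> s1 sb; split; last exact: cap.
have VE x : t1 m <= x -> x < b -> V (cross E x) <= u + early m * (b - cross E x).
  by move=> x1 xb; rewrite -(deviation_early _ (le_b _ x1 xb)).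
apply/le_anti; rewrite VE//=.
(* In terms of the distance [x] to [b], the user [b - x] could cross, still early, at the time
   chosen by [b - mu / lam * x]; not gaining from this means [p (mu / lam * x) <= p x]. Being a
   driver gives the crude bound [u + e * b - e * x <= p x] that starts the iteration. *)
pose p (x : R) : R := V (cross E (b - x)) + early m * cross E (b - x).
have lam0 := lam_gt0.
suff : u + early m * b <= p (b - s) by rewrite /p subKr; lra.
apply: (@le_of_contraction _ p (mu / lam) (early m) _ (b - t1 m)).
- by rewrite divr_gt0//= ltr_pdivrMr// mul1r.
- exact: ltW.
- move=> x /andP[]; rewrite /p => x0 xX.
  have rx0 : 0 < mu / lam * x by rewrite mulr_gt0// divr_gt0.
  have rxx : mu / lam * x < x.
    by rewrite -[ltRHS]mul1r ltr_pM2r// ltr_pdivrMr// mul1r.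
  have cross_le : cross E (b - mu / lam * x) <= b - x.
    have := cap (b - mu / lam * x); rewrite subKr.
    have -> : lam * (mu / lam * x) = mu * x by field; rewrite gt_eqF.
    by rewrite ler_pM2l//; move/(_ ltac:(lra) ltac:(lra)); lra.
  have cx : car_user m E (b - x) by apply: cu; lra.
  have := @best_cross (b - x) (cross E (b - mu / lam * x)) cx.
  rewrite (deviation_early _ cross_le).
  by have := deviation_ge_early (cross E (b - x)) (b - x); lra.
- move=> x /andP[]; rewrite /p => x0 xX.
  have cx : car_user m E (b - x) by apply: cu; lra.
  have := drv _ cx.
  by have := deviation_ge_early (cross E (b - x)) (b - x); lra.
- by rewrite subr_gt0 sb lerB.
Qed.

(** The time reversal of [early_users]: users are indexed by their distance after [c], and the
    quantity that is compared is [V - L * t]. *)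
Lemma late_users s : c < s -> s <= t2 m ->
  V (cross E s) = u + late m * (cross E s - c) /\
  lam * (s - c) <= mu * (cross E s - c).
Proof.
case: (eqE) => fE _ _; case: (marginal) => -[t1b bc ct2 u0 ugap] [Vb Vc _ right drv].
have cu x : c < x -> x <= t2 m -> car_user m E x.
  move=> cx x2; split; rewrite ?(right x)// x2 andbT.
  by rewrite (le_trans t1b)// (le_trans bc)// ltW.
have ge_c x : c < x -> x <= t2 m -> c <= cross E x.
  move=> cx x2; rewrite leNgt; apply/negP => xc.
  have := Vc (cross E x); rewrite (deviation_early _ (ltW xc)).
  have := drv _ (cu _ cx x2); have := deviation_ge_early (cross E x) x.
  have : 0 < early m * (x - c) by rewrite mulr_gt0 ?subr_gt0.
  lra.
have cap x : c < x -> x <= t2 m -> lam * (x - c) <= mu * (cross E x - c).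
  move=> cx x2; apply: (@full_share_le_capacity E `]c, x]) => //.
  - by move=> z /=; rewrite !in_itv/=; lra.
  - exact: ge_c.
  - by rewrite lebesgue_measure_itv/= lte_fin cx EFinB.
  - move=> z /=; rewrite in_itv/= => /andP[cz zx].
    have z2 := le_trans zx x2; split; first exact: right.
    rewrite ge_c//=; case: fE => _ _ mono _.
    by apply: mono => //; exact: cu.
move=> cs s2; split; last exact: cap.
have VE x : c < x -> x <= t2 m -> V (cross E x) <= u + late m * (cross E x - c).
  by move=> cx x2; rewrite -(deviation_late _ (ge_c _ cx x2)).
apply/le_anti; rewrite VE//=.
pose p (x : R) : R := V (cross E (c + x)) - late m * cross E (c + x).
have lam0 := lam_gt0.
suff : u - late m * c <= p (s - c) by rewrite /p (addrC c) subrK; lra.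
apply: (@le_of_contraction _ p (mu / lam) (late m) _ (t2 m - c)).
- by rewrite divr_gt0//= ltr_pdivrMr// mul1r.
- exact: ltW.
- move=> x /andP[]; rewrite /p => x0 xX.
  have rx0 : 0 < mu / lam * x by rewrite mulr_gt0// divr_gt0.
  have rxx : mu / lam * x < x.
    by rewrite -[ltRHS]mul1r ltr_pM2r// ltr_pdivrMr// mul1r.
  have cross_ge : c + x <= cross E (c + mu / lam * x).
    have := cap (c + mu / lam * x); rewrite (addrC c) addrK.
    have -> : lam * (mu / lam * x) = mu * x by field; rewrite gt_eqF.
    by rewrite ler_pM2l//; move/(_ ltac:(lra) ltac:(lra)); lra.
  have cx : car_user m E (c + x) by apply: cu; lra.
  have := @best_cross (c + x) (cross E (c + mu / lam * x)) cx.
  rewrite (deviation_late _ cross_ge).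
  by have := deviation_ge_late (cross E (c + x)) (c + x); lra.
- move=> x /andP[]; rewrite /p => x0 xX.
  have cx : car_user m E (c + x) by apply: cu; lra.
  have := drv _ cx.
  by have := deviation_ge_late (cross E (c + x)) (c + x); lra.
- by rewrite subr_gt0 cs lerB.
Qed.

(** Crossing at [t < b] is worth at most [u + e * (b - t)], less than the [u + e * (s - t)] required
    by a driver [s > b]; symmetrically after [c]. *)
Lemma middle_users s : b < s < c -> car_user m E s -> b <= cross E s <= c.
Proof.
case: (marginal) => _ [Vb Vc _ _ drv] /andP[bs sc] /drv Vs.
rewrite !leNgt; apply/andP; split; apply/negP => out.
  have := Vb (cross E s); rewrite (deviation_early _ (ltW out)).
  have := deviation_ge_early (cross E s) s.
  have : 0 < early m * (s - b) by rewrite mulr_gt0 ?subr_gt0.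
  lra.
have := Vc (cross E s); rewrite (deviation_late _ (ltW out)).
have := deviation_ge_late (cross E s) s.
have : 0 < late m * (c - s) by rewrite mulr_gt0 ?subr_gt0.
lra.
Qed.

(** Outside [[b, c]] the value of the crossing time is known exactly, and capacity pushes this time
    at least as far out as planned; inside, the deviation penalty is paid from the surplus. Delay
    and distance to the plan stay on the left so that equality of the tolls forces both to
    vanish. *)
Lemma toll_le_peak_toll s : car_user m E s ->
  toll (cross E s) + delay E (cross E s)
    + Num.min (early m) (late m) * `|planned_cross b c s - cross E s|
  <= peak_toll (gap - u) b c (planned_cross b c s).
Proof.
move=> cs; case: (marginal) => -[t1b bc ct2 u0 ugap] [_ _ _ _ drv].
case: (cs) => /andP[s1 s2] _; have lam0 := lam_gt0.
have min_early : Num.min (early m) (late m) <= early m by rewrite ge_min lexx.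
have min_late : Num.min (early m) (late m) <= late m by rewrite ge_min lexx orbT.
have [sb|bs] := ltP s b.
  have [] := early_users s1 sb; rewrite planned_cross_early ?(ltW sb)//.
  rewrite /surplus => VE; rewrite -ler_pdivrMl// mulrA [_^-1 * _]mulrC => early_cross.
  have r0 : 0 <= lam / mu * (b - s).
    by apply: mulr_ge0; [apply: divr_ge0; exact: ltW | lra].
  rewrite peak_toll_early//; last by lra.
  rewrite ger0_norm; last by lra.
  have : 0 <= b - lam / mu * (b - s) - cross E s by lra.
  by move/(ler_wpM2r) => /(_ _ _ min_early); lra.
have [cs'|sc] := ltP c s.
  have [] := late_users cs' s2; rewrite planned_cross_late ?(ltW cs')//.
  rewrite /surplus => VE; rewrite -ler_pdivrMl// mulrA [_^-1 * _]mulrC => late_cross.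
  have r0 : 0 <= lam / mu * (s - c).
    by apply: mulr_ge0; [apply: divr_ge0; exact: ltW | lra].
  rewrite peak_toll_late//; last by lra.
  rewrite ler0_norm; last by lra.
  have : 0 <= - (c + lam / mu * (s - c) - cross E s) by lra.
  by move/(ler_wpM2r) => /(_ _ _ min_late); lra.
rewrite planned_cross_mid ?bs// peak_toll_mid ?bs//.
have := drv _ cs; rewrite /surplus.
suff : Num.min (early m) (late m) * `|s - cross E s|
    <= deviation m (cross E s) s by lra.
have [ts|st] := leP (cross E s) s.
  by rewrite deviation_early// ger0_norm ?ler_wpM2r ?subr_ge0.
by rewrite deviation_late ?(ltW st)// distrC ger0_norm ?ler_wpM2r ?subr_ge0 ?(ltW st).
Qed.

End Equilibrium.

(** * The revenue bound *)

Lemma max_measurable (f : R -> R) (D : set R) :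
  measurable_fun D f -> measurable_fun D (fun s => Num.max (f s) 0).
Proof. by move=> mf; exact: measurable_maxr. Qed.

Lemma measurable_planned_cross b c (D : set R) :
  measurable_fun D (planned_cross b c).
Proof.
apply: measurable_funD; first apply: measurable_funB => //.
- apply: measurable_funM => //; apply: max_measurable.
  exact: measurable_funB.
- apply: measurable_funM => //; apply: max_measurable.
  exact: measurable_funB.
Qed.

Lemma measurable_peak_toll p b c (D : set R) :
  measurable_fun D (peak_toll p b c).
Proof.
apply: measurable_funB; first apply: measurable_funB => //.
- apply: measurable_funM => //; apply: max_measurable.
  exact: measurable_funB.
- apply: measurable_funM => //; apply: max_measurable.
  exact: measurable_funB.
Qed.

(* Revenue when [lam * x] early and [lam * y] late users cross at rate [mu] before
   [b] and after [c], [N] users cross on time, and everybody pays [peak_toll p]. *)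
Definition profit (p x y N : R) : R :=
  p * (lam * (x + y) + N)
  - lam ^+ 2 / (2 * mu) * (early m * x ^+ 2 + late m * y ^+ 2).

(** Before [b] and after [c] everybody drives and the integrand is affine in [s]; on [[b, c]] the
    toll is the constant [p], so only the mass [N] of drivers matters. *)
Lemma planned_revenue E p b c N : feasible m E ->
  t1 m <= b -> b <= c -> c <= t2 m -> 0 <= p ->
  (forall s, t1 m <= s -> s < b -> share E s = 1) ->
  (forall s, c < s -> s <= t2 m -> share E s = 1) ->
  (\int[lebesgue_measure]_(s in `[b, c]) (lam * share E s)%:E = N%:E)%E ->
  (forall s, t1 m <= s <= t2 m ->
    0 <= lam * share E s * peak_toll p b c (planned_cross b c s)) ->
  (\int[lebesgue_measure]_(s in `[t1 m, t2 m])
      (lam * share E s * peak_toll p b c (planned_cross b c s))%:E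
   = (profit p (b - t1 m) (t2 m - c) N)%:E)%E.
Proof.
move=> fE t1b bc ct2 p0 left right massN pos.
have mpeak : measurable_fun `[t1 m, t2 m]
    (fun s => lam * share E s * peak_toll p b c (planned_cross b c s)).
  apply: measurable_funM; first exact: measurable_car_mass.
  apply: measurableT_comp; first exact: measurable_peak_toll.
  exact: measurable_planned_cross.
have r0 : 0 <= lam / mu by apply: divr_ge0; rewrite ltW ?lam_gt0.
rewrite (ge0_integral_split3 t1b bc ct2)//.
have -> : (\int[lebesgue_measure]_(s in `[t1 m, b[)
      (lam * share E s * peak_toll p b c (planned_cross b c s))%:E =
    \int[lebesgue_measure]_(s in `[t1 m, b])
      (lam * (p - early m * (lam / mu * b))
       + lam * early m * (lam / mu) * s)%:E)%E.
  rewrite -integral_itv_bndo_bndc; last first.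
    by apply/measurable_EFinP; apply: measurable_funD => //; apply: measurable_funM.
  apply: eq_integral => s; rewrite inE/= in_itv/= => /andP[s1 sb].
  rewrite left// planned_cross_early ?(ltW sb)// peak_toll_early//.
    by congr EFin; ring.
  have : 0 <= lam / mu * (b - s) by apply: mulr_ge0; lra.
  by lra.
have -> : (\int[lebesgue_measure]_(s in `]c, t2 m])
      (lam * share E s * peak_toll p b c (planned_cross b c s))%:E =
    \int[lebesgue_measure]_(s in `[c, t2 m])
      (lam * (p + late m * (lam / mu * c))
       + (- (lam * late m * (lam / mu))) * s)%:E)%E.
  rewrite -integral_itv_obnd_cbnd; last first.
    by apply/measurable_EFinP; apply: measurable_funD => //; apply: measurable_funM.
  apply: eq_integral => s; rewrite inE/= in_itv/= => /andP[cs s2].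
  rewrite right// planned_cross_late ?(ltW cs)// peak_toll_late//.
    by congr EFin; ring.
  have : 0 <= lam / mu * (s - c) by apply: mulr_ge0; lra.
  by lra.
have -> : (\int[lebesgue_measure]_(s in `[b, c])
      (lam * share E s * peak_toll p b c (planned_cross b c s))%:E = (p * N)%:E)%E.
  rewrite EFinM -massN -ge0_integralZl//.
  - apply: eq_integral => s; rewrite inE/= in_itv/= => sI.
    by rewrite planned_cross_mid// peak_toll_mid// -EFinM mulrC.
  - apply/measurable_EFinP; apply: measurable_funS (measurable_car_mass fE) => //.
    by move=> s /=; rewrite !in_itv/=; lra.
  - move=> s; rewrite /= in_itv/= lee_fin => sI; apply: car_mass_ge0 => //; lra.
rewrite !integral_affine// -!EFinD /profit; congr EFin.
by field; rewrite gt_eqF.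
Qed.

(** The capacity bound is applied on the open interval, where crossing times are known to stay in
    [[b, c]]; the endpoints are negligible. *)
Lemma middle_mass E b c : feasible m E -> t1 m <= b -> b <= c -> c <= t2 m ->
  (forall s, b < s < c -> car_user m E s -> b <= cross E s <= c) ->
  exists N, [/\ 0 <= N, N <= mu * (c - b) &
    (\int[lebesgue_measure]_(s in `[b, c]) (lam * share E s)%:E = N%:E)%E].
Proof.
move=> fE t1b bc ct2 mid.
have bound : (\int[lebesgue_measure]_(s in `[b, c]) (lam * share E s)%:E
    <= (mu * (c - b))%:E)%E.
  rewrite (@integral_itv_bndoo _ b c _ true false); last first.
    apply/measurable_EFinP; apply: measurable_funS (measurable_car_mass fE) => //.
    by move=> s /=; rewrite !in_itv/=; lra.
  apply: car_mass_le_capacity => //.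
    by move=> s /=; rewrite !in_itv/=; lra.
  move=> s /=; rewrite in_itv/= => sI s0; apply: mid => //.
  by split => //; lra.
have pos : (0 <= \int[lebesgue_measure]_(s in `[b, c]) (lam * share E s)%:E)%E.
  apply: integral_ge0 => s; rewrite /= in_itv/= lee_fin => sI.
  by apply: car_mass_ge0 => //; lra.
have fin : (\int[lebesgue_measure]_(s in `[b, c]) (lam * share E s)%:E)%E
    \is a fin_num.
  by rewrite ge0_fin_numE// (le_lt_trans bound) ?ltry.
exists (fine (\int[lebesgue_measure]_(s in `[b, c]) (lam * share E s)%:E)%E).
by rewrite fineK// -!lee_fin fineK.
Qed.

Lemma measurable_collected toll E : policy toll -> feasible m E ->
  measurable_fun `[t1 m, t2 m] (fun s => lam * share E s * toll (cross E s)).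
Proof.
move=> [mtoll _] fE; apply: measurable_funM; first exact: measurable_car_mass.
by apply: measurableT_comp => //; case: fE => -[].
Qed.

Lemma car_toll_bounds toll E u b c s : policy toll -> equilibrium m toll E ->
  marginal_users m toll E u b c -> t1 m <= s <= t2 m ->
  0 <= lam * share E s * toll (cross E s)
    <= lam * share E s * peak_toll (gap - u) b c (planned_cross b c s).
Proof.
move=> polT eqE mrg sI; case: (eqE) => fE _ _.
have mass0 := car_mass_ge0 fE sI.
rewrite mulr_ge0//=; last by case: polT.
have [s0|] := ltP 0 (share E s); last first.
  move=> s0; suff -> : share E s = 0 by rewrite mulr0 !mul0r.
  by apply/le_anti; rewrite s0/=; case: fE => _ /(_ _ sI)/andP[].
apply: ler_wpM2l => //.
have cs : car_user m E s by [].
have := toll_le_peak_toll eqE mrg cs.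
have := equilibrium_delay_ge0 eqE (cross E s).
have : 0 <= Num.min (early m) (late m) * `|planned_cross b c s - cross E s|.
  by rewrite mulr_ge0// le_min !ltW.
by lra.
Qed.

(** Integrates the pointwise bound on tolls. The exact integral of the dominating function is
    recorded too, because the equality case in [optimal_marginal_users] compares integrands. *)
Lemma collected_le_profit toll E u b c : policy toll -> equilibrium m toll E ->
  marginal_users m toll E u b c ->
  exists N, [/\ 0 <= N, N <= mu * (c - b),
    (\int[lebesgue_measure]_(s in `[b, c]) (lam * share E s)%:E = N%:E)%E,
    (\int[lebesgue_measure]_(s in `[t1 m, t2 m])
      (lam * share E s * peak_toll (gap - u) b c (planned_cross b c s))%:E
      = (profit (gap - u) (b - t1 m) (t2 m - c) N)%:E)%E &
    (collected m toll E <= (profit (gap - u) (b - t1 m) (t2 m - c) N)%:E)%E].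
Proof.
move=> polT eqE mrg; case: (eqE) => fE _ _.
case: (mrg) => -[t1b bc ct2 u0 ugap] [_ _ left right _].
have [|N [N0 Nle NE]] := middle_mass fE t1b bc ct2.
  by move=> s sI cs; apply: (middle_users mrg).
have bounds := car_toll_bounds polT eqE mrg.
have p0 : 0 <= gap - u by lra.
have revE := planned_revenue fE t1b bc ct2 p0 left right NE.
exists N; split => //.
  by apply: revE => s /bounds/andP[]; exact: le_trans.
rewrite -revE; last by move=> s /bounds/andP[]; exact: le_trans.
apply: ge0_le_integral => //.
- by move=> s; rewrite /= in_itv/= lee_fin => /bounds/andP[].
- apply/measurable_EFinP; exact: measurable_collected.
- apply/measurable_EFinP; apply: measurable_funM; first exact: measurable_car_mass.
  apply: measurableT_comp; first exact: measurable_peak_toll.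
  exact: measurable_planned_cross.
- by move=> s; rewrite /= in_itv/= lee_fin => /bounds/andP[].
Qed.

(** * Maximization of the profit *)

Local Notation T := (t2 m - t1 m).

(** The peaks are lengths in desired time; the corresponding crossing times spread over [lam / mu]
    times as much. The split of [(1 - fstar m) * T] equalizes [early m * early_peak] and
    [late m * late_peak]. *)
Definition early_peak : R := late m / (early m + late m) * ((1 - fstar m) * T).
Definition late_peak : R := early m / (early m + late m) * ((1 - fstar m) * T).

(* Derivative of [profit] with respect to either peak at the optimum, where the
   two partial derivatives agree. *)
Definition peak_slack : R :=
  gap * (lam - mu)
  - lam ^+ 2 / mu * (early m * late m / (early m + late m)) * ((1 - fstar m) * T).

Lemma massE : mass m = lam * T.
Proof. by rewrite /arrival_rate divfK// gt_eqF// subr_gt0. Qed.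

(** Normalization in which [gap * (lam - mu) = scale * ratio], [fstar m] is [1 - ratio] cut at 0,
    and the case distinction of [optimal_revenue] reads [ratio <= 1]. *)
Let scale := lam ^+ 2 / mu * (early m * late m / (early m + late m)) * T.

Let ratio := gap * mu * (early m + late m) / (mass m * early m * late m)
  * (1 - mu / lam).

Let scale_gt0 : 0 < scale.
Proof.
have lam0 := lam_gt0; apply: mulr_gt0; last by rewrite subr_gt0.
apply: mulr_gt0; first by rewrite divr_gt0// exprn_gt0.
by apply: divr_gt0; [exact: mulr_gt0 | exact: addr_gt0].
Qed.

Let gapE : gap * (lam - mu) = scale * ratio.
Proof.
have := lam_gt0; have : 0 < T by rewrite subr_gt0.
rewrite /scale /ratio massE => T0 lam0; field.
by rewrite !gt_eqF// addr_gt0.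
Qed.

Let ratio_ge0 : 0 <= ratio.
Proof.
by rewrite -(pmulr_rge0 _ scale_gt0) -gapE mulr_ge0 ?subr_ge0// ltW.
Qed.

Lemma fstarE : fstar m = Num.max (1 - ratio) 0. Proof. by []. Qed.

Lemma fstar_bounds : 0 <= fstar m <= 1.
Proof.
by rewrite fstarE le_max lexx orbT ge_max ler01 andbT; have := ratio_ge0; lra.
Qed.

Let peak_slackE : peak_slack = scale * (ratio - (1 - fstar m)).
Proof. by rewrite /peak_slack gapE /scale; ring. Qed.

Lemma peak_slack_ge0 : 0 <= peak_slack.
Proof.
rewrite peak_slackE mulr_ge0 ?(ltW scale_gt0)// fstarE.
have : 1 - ratio <= Num.max (1 - ratio) 0 by rewrite le_max lexx.
by lra.
Qed.

(** Complementary slackness: either the optimum is interior and the derivative vanishes, or the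
    peaks fill [[t1, t2]] and [fstar m] is 0. *)
Lemma peak_slack_fstar : peak_slack * fstar m = 0.
Proof.
rewrite peak_slackE fstarE; have [r|r] := leP (1 - ratio) 0.
  by rewrite mulr0.
by ring.
Qed.

Lemma optimal_revenueE :
  optimal_revenue m = profit gap early_peak late_peak (mu * (fstar m * T)).
Proof.
have lam0 := lam_gt0; have T0 : 0 < T by rewrite subr_gt0.
have EL0 : 0 < early m + late m by rewrite addr_gt0.
have D0 : 0 < lam - mu by rewrite subr_gt0.
have -> : optimal_revenue m = if ratio <= 1
    then gap * mass m * (mu / lam)
       + gap ^+ 2 * mu * (early m + late m) / (2 * early m * late m)
         * (1 - mu / lam) ^+ 2
    else gap * mass m
       - mass m ^+ 2 / (2 * mu) * (early m * late m / (early m + late m)).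
  rewrite /optimal_revenue /=; congr (if _ then _ else _).
  rewrite -[ratio <= 1](ler_pM2l scale_gt0) mulr1 -gapE -ler_pdivlMr//.
  congr (_ <= _); rewrite /scale massE; field.
  by rewrite !gt_eqF.
have [r1|r1] := leP ratio 1.
  have fE : fstar m = 1 - ratio by rewrite fstarE max_l//; lra.
  rewrite /profit /early_peak /late_peak fE massE /ratio massE; field.
  by rewrite !gt_eqF.
have fE : fstar m = 0 by rewrite fstarE max_r//; lra.
rewrite /profit /early_peak /late_peak fE massE; field.
by rewrite !gt_eqF.
Qed.

(** Completing the squares around the two peaks. Each term is nonnegative once [x + y <= T] and
    [N <= mu * (T - x - y)], which gives the bound; being an identity, it also settles the equality
    case. *)
Lemma optimal_revenue_sub_profit x y N :
  optimal_revenue m - profit gap x y N =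
  peak_slack * (T - x - y) + gap * (mu * (T - x - y) - N)
  + lam ^+ 2 / (2 * mu)
    * (early m * (x - early_peak) ^+ 2 + late m * (y - late_peak) ^+ 2).
Proof.
have lam0 := lam_gt0; have T0 : 0 < T by rewrite subr_gt0.
have EL0 : 0 < early m + late m by rewrite addr_gt0.
rewrite optimal_revenueE; apply/eqP; rewrite -subr_eq0; apply/eqP.
(* As rational expressions the two sides differ by this product, which vanishes only through
   complementary slackness. *)
transitivity (- (peak_slack * fstar m) * T);
  last by rewrite peak_slack_fstar oppr0 mul0r.
rewrite /profit /peak_slack /early_peak /late_peak; field.
by rewrite !gt_eqF.
Qed.

Lemma profitB u x y N :
  profit (gap - u) x y N = profit gap x y N - u * (lam * (x + y) + N).
Proof. by rewrite /profit; ring. Qed.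

Lemma profit_le_optimal u b c N : t1 m <= b -> b <= c -> c <= t2 m ->
  0 <= u -> 0 <= N <= mu * (c - b) ->
  profit (gap - u) (b - t1 m) (t2 m - c) N <= optimal_revenue m.
Proof.
move=> t1b bc ct2 u0 /andP[N0 Nle]; rewrite profitB.
have := optimal_revenue_sub_profit (b - t1 m) (t2 m - c) N.
have -> : T - (b - t1 m) - (t2 m - c) = c - b by ring.
have : 0 <= peak_slack * (c - b) by rewrite mulr_ge0 ?peak_slack_ge0 ?subr_ge0.
have : 0 <= gap * (mu * (c - b) - N) by rewrite mulr_ge0 ?subr_ge0.
have : 0 <= lam ^+ 2 / (2 * mu) * (early m * (b - t1 m - early_peak) ^+ 2
    + late m * (t2 m - c - late_peak) ^+ 2).
  apply: mulr_ge0; last by rewrite addr_ge0// mulr_ge0 ?sqr_ge0// ltW.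
  by rewrite divr_ge0 ?sqr_ge0// mulr_ge0// ltW.
have : 0 <= u * (lam * (b - t1 m + (t2 m - c)) + N).
  rewrite mulr_ge0// addr_ge0// mulr_ge0 ?(ltW lam_gt0)//; lra.
by lra.
Qed.

Lemma collected_le_optimal toll E : policy toll -> equilibrium m toll E ->
  (collected m toll E <= (optimal_revenue m)%:E)%E.
Proof.
move=> polT eqE; have gap0 : 0 <= gap by rewrite subr_ge0.
have [u [b [c mrg]]] :=
  exists_marginal_users early_gt0 late_gt0 polT eqE (ltW t1_lt_t2) gap0.
have [N [N0 Nle _ _ le_profit]] := collected_le_profit polT eqE mrg.
case: mrg => -[t1b bc ct2 u0 _] _.
by apply: le_trans le_profit _; rewrite lee_fin profit_le_optimal// N0.
Qed.

Lemma revenue_le_optimal toll : policy toll ->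
  (revenue m toll <= (optimal_revenue m)%:E)%E.
Proof.
move=> polT; apply: ge_ereal_sup => _ [E eqE <-].
exact: collected_le_optimal.
Qed.

(** * The optimal policy *)

(** Puts all flows on the fixed domain [[t1, t2]], so that they can be added and compared almost
    everywhere. *)
Lemma car_flowE E (B : set R) : (car_flow m E B =
  \int[lebesgue_measure]_(s in `[t1 m, t2 m])
    (lam * share E s * \1_B (cross E s))%:E)%E.
Proof.
rewrite /car_flow integral_mkcondr; apply: eq_integral => s _.
rewrite patchE indicE /=.
have -> : (s \in cross E @^-1` B) = (cross E s \in B) by [].
by case: (_ \in B); rewrite ?mulr1 ?mulr0.
Qed.

Lemma measurable_car_mass_at E (B : set R) : feasible m E -> measurable B ->
  measurable_fun `[t1 m, t2 m]
    (fun s => lam * share E s * \1_B (cross E s)).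
Proof.
move=> fE mB; apply: measurable_funM; first exact: measurable_car_mass.
apply: measurableT_comp; first exact: measurable_indic.
by case: fE => -[].
Qed.

(* Subintervals cannot carry less than capacity: the others would have to carry
   more. *)
Lemma crosses_over_of_mass E a d : feasible m E -> a <= d ->
  {ae lebesgue_measure, forall s, `[t1 m, t2 m]%classic s ->
     0 < share E s -> a <= cross E s <= d} ->
  (\int[lebesgue_measure]_(s in `[t1 m, t2 m]) (lam * share E s)%:E
   = (mu * (d - a))%:E)%E ->
  crosses_over m E a d.
Proof.
move=> fE ad supp total.
have mass0 (s : R) : `[t1 m, t2 m]%classic s -> 0 <= lam * share E s.
  by rewrite /= in_itv/=; exact: car_mass_ge0.
have massat0 B (s : R) : `[t1 m, t2 m]%classic s ->
    0 <= lam * share E s * \1_B (cross E s).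
  by move=> sI; rewrite mulr_ge0 ?mass0// indicE.
have mat B : measurable B -> measurable_fun `[t1 m, t2 m]
    (fun s => (lam * share E s * \1_B (cross E s))%:E).
  by move=> mB; apply/measurable_EFinP; exact: measurable_car_mass_at.
have driver (s : R) : `[t1 m, t2 m]%classic s -> share E s = 0 \/ 0 < share E s.
  rewrite /= in_itv/= => sI; have [|s0] := ltP 0 (share E s); first by right.
  left; apply/le_anti; rewrite s0/=.
  by case: fE => _ /(_ _ sI)/andP[].
case: (fE) => _ _ _ [cap _ _ _].
split; last first.
  rewrite car_flowE -(@integral0 _ _ _ lebesgue_measure `[t1 m, t2 m]).
  apply: ae_eq_integral => //.
    by apply: mat; apply: measurableC.
  apply: lebesgue_aeS supp => s supp sI; congr EFin.
  have [->|s0] := driver s sI; first by rewrite mulr0 mul0r.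
  rewrite indicE memNset ?mulr0//= => nI; apply: nI.
  by rewrite /= in_itv/=; exact: supp.
move=> t t' at_ tt' t'd; apply/le_anti; rewrite cap//=.
have flow0 : (0 <= car_flow m E `[t, t'])%E.
  by rewrite car_flowE; apply: integral_ge0 => s /massat0 ?; rewrite lee_fin.
have flow_fin : car_flow m E `[t, t'] \is a fin_num.
  by rewrite ge0_fin_numE// (le_lt_trans (cap _ _ tt'))// ltry.
(* The three closed intervals cover [[a, d]]; counting their common endpoints twice only enlarges
   the right-hand side. *)
have : (\int[lebesgue_measure]_(s in `[t1 m, t2 m]) (lam * share E s)%:E
    <= car_flow m E `[a, t] + car_flow m E `[t, t'] + car_flow m E `[t', d])%E.
  have pos B1 B2 (s : R) : `[t1 m, t2 m]%classic s ->
      (0 <= (lam * share E s * \1_B1 (cross E s))%:E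
            + (lam * share E s * \1_B2 (cross E s))%:E)%E.
    by move=> sI; rewrite adde_ge0// lee_fin massat0.
  rewrite !car_flowE -!ge0_integralD//;
    try by [exact: mat | exact: pos | apply: emeasurable_funD; exact: mat
           | move=> s sI; rewrite lee_fin massat0].
  apply: ae_ge0_le_integral => //;
    try by [move=> s sI; rewrite lee_fin mass0
           | apply/measurable_EFinP; exact: measurable_car_mass
           | move=> s sI; rewrite adde_ge0 ?pos// lee_fin massat0
           | do !apply: emeasurable_funD; exact: mat].
  apply: lebesgue_aeS supp => s supp sI; rewrite -!EFinD lee_fin -!mulrDr.
  have [->|s0] := driver s sI; first by rewrite mulr0 !mul0r.
  rewrite ler_peMr ?mass0// !indicE !mem_setE !in_itv/=.
  have /andP[ac cd] := supp sI s0.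
  have [ct|tc] := leP (cross E s) t; first by rewrite ac/= -addrA lerDl addr_ge0.
  have [ct'|tc'] := leP (cross E s) t'.
    by rewrite (ltW tc)/= addrAC lerDr addr_ge0.
  by rewrite (ltW tc') cd/= lerDr addr_ge0.
rewrite total => /le_trans/(_ (leeD (leeD (cap _ _ at_) (lexx _)) (cap _ _ t'd))).
rewrite -(fineK flow_fin) -!EFinD !lee_fin; lra.
Qed.

Lemma integral_supported_le (D : set R) (k p q : R) (f : R -> R) :
  measurable D -> measurable_fun D f -> 0 <= k ->
  (forall s, D s -> 0 <= f s <= k) ->
  (forall s, D s -> f s != 0 -> p <= s <= q) ->
  (\int[lebesgue_measure]_(s in D) (f s)%:E <= (k * Num.max (q - p) 0)%:E)%E.
Proof.
move=> mD mf k0 fk supp.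
apply: (@le_trans _ _ (\int[lebesgue_measure]_(s in D)
    (k%:E * (\1_`[p, q] s)%:E))%E).
  apply: ge0_le_integral => //.
  - by move=> s /fk/andP[]; rewrite lee_fin.
  - exact/measurable_EFinP.
  - apply/measurable_EFinP; exact: measurable_funM.
  - move=> s Ds; rewrite -EFinM lee_fin indicE mem_setE in_itv/=.
    have [->|f0] := eqVneq (f s) 0; first by rewrite mulr_ge0.
    by rewrite supp// mulr1; have /andP[] := fk _ Ds.
rewrite ge0_integralZl//; last first.
  by apply/measurable_EFinP; exact: measurable_indic.
rewrite EFinM lee_wpmul2l ?lee_fin// integral_indic//.
apply: (@le_trans _ _ (lebesgue_measure (`[p, q]%classic : set R))).
  by apply: le_measure; rewrite ?inE//; apply: measurableI.
rewrite lebesgue_measure_itv/= lte_fin; case: ltP => _.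
  by rewrite -EFinB lee_fin le_max lexx.
by rewrite lee_fin le_max lexx orbT.
Qed.

Lemma lebesgue_measure_itv_le (a b : R) (x y : bool) : a <= b ->
  lebesgue_measure ([set` Interval (BSide x a) (BSide y b)] : set R)
  = (b - a)%:E.
Proof.
rewrite lebesgue_measure_itv/= lte_fin.
by rewrite le_eqVlt => /orP[/eqP->|->]; rewrite ?ltxx ?subrr// EFinB.
Qed.

Lemma total_car_mass E b c N : feasible m E ->
  t1 m <= b -> b <= c -> c <= t2 m ->
  (forall s, t1 m <= s -> s < b -> share E s = 1) ->
  (forall s, c < s -> s <= t2 m -> share E s = 1) ->
  (\int[lebesgue_measure]_(s in `[b, c]) (lam * share E s)%:E = N%:E)%E ->
  (\int[lebesgue_measure]_(s in `[t1 m, t2 m]) (lam * share E s)%:E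
   = (lam * (b - t1 m) + N + lam * (t2 m - c))%:E)%E.
Proof.
move=> fE t1b bc ct2 left right massN.
rewrite (ge0_integral_split3 t1b bc ct2); last 2 first.
- exact: measurable_car_mass.
- by move=> s sI; exact: car_mass_ge0.
rewrite massN !integral_full_share; first last.
- by move=> s /=; rewrite in_itv/= => /andP[]; exact: left.
- by move=> s /=; rewrite in_itv/= => /andP[]; exact: right.
by rewrite !lebesgue_measure_itv_le// -!EFinM -!EFinD.
Qed.

(** On [[b, c]] the drivers are thinned from density [lam] to [mu], so that they can all cross on
    time without a queue. *)
Definition planned_share (b c s : R) : R := 1 - (1 - mu / lam) * \1_`[b, c] s.

Definition planned_profile (b c : R) : profile R :=
  Profile (planned_share b c) (planned_cross b c) (fun=> 0).

Lemma planned_share_mid b c s : b <= s <= c -> planned_share b c s = mu / lam.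
Proof.
move=> sI; rewrite /planned_share indicE mem_setE in_itv/= sI mulr1.
by rewrite opprB addrC subrK.
Qed.

Lemma planned_share_out b c s : ~~ (b <= s <= c) -> planned_share b c s = 1.
Proof.
by move=> /negbTE sI; rewrite /planned_share indicE mem_setE in_itv/= sI mulr0 subr0.
Qed.

Lemma ratio_bounds : 0 < mu / lam < 1.
Proof.
have lam0 := lam_gt0.
by rewrite divr_gt0//= ltr_pdivrMr// mul1r.
Qed.

Lemma planned_share_bounds b c s : 0 < planned_share b c s <= 1.
Proof.
have := ratio_bounds; have [sI|sI] := boolP (b <= s <= c).
  by rewrite planned_share_mid//; lra.
by rewrite planned_share_out//; lra.
Qed.

Lemma measurable_planned_share b c (D : set R) :
  measurable_fun D (planned_share b c).
Proof.
apply: measurable_funB => //; exact: measurable_funM.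
Qed.

Lemma planned_cross_le b c : b <= c ->
  {homo planned_cross b c : s s' / s <= s'}.
Proof.
move=> bc s s' ss'; have lam0 := lam_gt0.
have r1 : 1 < lam / mu by rewrite ltr_pdivlMr// mul1r.
have mul x y : x <= y -> lam / mu * x <= lam / mu * y.
  by move=> xy; rewrite ler_pM2l//; lra.
have mul0 x : 0 <= x -> 0 <= lam / mu * x by move=> /mul; rewrite mulr0.
have [sb|bs] := leP s b.
  rewrite planned_cross_early//; have [s'b|bs'] := leP s' b.
    by rewrite planned_cross_early//; have := mul (b - s') (b - s); lra.
  have [s'c|cs'] := leP s' c.
    by rewrite planned_cross_mid ?(ltW bs')//; have := mul0 (b - s); lra.
  rewrite planned_cross_late ?(ltW cs')//.
  by have := mul0 (b - s); have := mul0 (s' - c); lra.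
have [sc|cs] := leP s c.
  rewrite planned_cross_mid ?(ltW bs)//; have [s'c|cs'] := leP s' c.
    by rewrite planned_cross_mid//; lra.
  by rewrite planned_cross_late ?(ltW cs')//; have := mul0 (s' - c); lra.
rewrite !planned_cross_late ?(ltW cs)//; last by lra.
by have := mul (s - c) (s' - c); lra.
Qed.

(** The three terms are the lengths of the parts of [[t, t']] before [b], between [b] and [c], and
    after [c]. *)
Lemma sum_overlap_le (b c t t' : R) : b <= c -> t <= t' ->
  Num.max (Num.min b t' - t) 0 + Num.max (Num.min c t' - Num.max b t) 0
    + Num.max (t' - Num.max c t) 0 <= t' - t.
Proof.
move=> bc tt'.
case: (leP b t') => ?; case: (leP c t') => ?; case: (leP b t) => ?;
  case: (leP c t) => ?;
  repeat match goal with |- context [Num.max ?x 0] => case: (leP x 0) => ? end;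
  lra.
Qed.

(** Outside [[b, c]] the plan stretches time by [lam / mu], turning the density [lam] of users into
    a crossing rate [mu]; inside, the thinned density is already [mu]. *)
Lemma planned_flow_le b c t t' : t1 m <= b -> b <= c -> c <= t2 m -> t <= t' ->
  (car_flow m (planned_profile b c) `[t, t'] <= (mu * (t' - t))%:E)%E.
Proof.
move=> t1b bc ct2 tt'; have lam0 := lam_gt0; rewrite car_flowE /=.
have /andP[q0 q1] := ratio_bounds.
have mulK x : mu / lam * (lam / mu * x) = x by field; rewrite !gt_eqF.
have mul x y : x <= y -> mu / lam * x <= mu / lam * y.
  by move=> xy; rewrite ler_pM2l.
pose f s : R := lam * planned_share b c s * \1_`[t, t'] (planned_cross b c s).
have mf (D : set R) : measurable_fun D f.
  apply: measurable_funM.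
    by apply: measurable_funM => //; exact: measurable_planned_share.
  apply: measurableT_comp; first exact: measurable_indic.
  exact: measurable_planned_cross.
have f0 s : 0 <= f s.
  have /andP[s0 _] := planned_share_bounds b c s.
  by rewrite /f mulr_ge0 ?indicE// mulr_ge0// ltW.
have fsupp s : f s != 0 -> t <= planned_cross b c s <= t'.
  rewrite /f indicE mem_setE in_itv/=.
  by case: (_ && _) => //; rewrite mulr0 eqxx.
have fle s : f s <= lam * planned_share b c s.
  have /andP[s0 _] := planned_share_bounds b c s.
  apply: ler_piMr; first by rewrite mulr_ge0 ?ltW.
  by rewrite indicE lern1 leq_b1.
suff : (\int[lebesgue_measure]_(s in `[t1 m, t2 m]) (f s)%:E
    <= (mu * (t' - t))%:E)%E by [].
rewrite (ge0_integral_split3 t1b bc ct2)//.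
(* [qt] and [rt] invert the early and the late branch of [planned_cross]. *)
pose qt x := b - mu / lam * (b - x).
pose rt x := c + mu / lam * (x - c).
have left_le : (\int[lebesgue_measure]_(s in `[t1 m, b[) (f s)%:E
    <= (lam * Num.max (qt (Num.min b t') - qt t) 0)%:E)%E.
  apply: integral_supported_le => //; first exact: ltW.
    move=> s /=; rewrite in_itv/= => /andP[_ sb]; rewrite f0/=.
    by rewrite (le_trans (fle s))// planned_share_out ?mulr1// leNgt sb.
  move=> s /=; rewrite in_itv/= => /andP[_ sb] /fsupp.
  rewrite planned_cross_early ?(ltW sb)// => /andP[ts st'].
  have := mul (lam / mu * (b - s)) (b - t); rewrite mulK.
  rewrite /qt; have [bt'|t'b] := leP b t'; first by rewrite subrr mulr0; lra.
  by have := mul (b - t') (lam / mu * (b - s)); rewrite mulK; lra.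
have right_le : (\int[lebesgue_measure]_(s in `]c, t2 m]) (f s)%:E
    <= (lam * Num.max (rt t' - rt (Num.max c t)) 0)%:E)%E.
  apply: integral_supported_le => //; first exact: ltW.
    move=> s /=; rewrite in_itv/= => /andP[cs _]; rewrite f0/=.
    by rewrite (le_trans (fle s))// planned_share_out ?mulr1// (leNgt s) cs andbF.
  move=> s /=; rewrite in_itv/= => /andP[cs _] /fsupp.
  rewrite planned_cross_late ?(ltW cs)// => /andP[ts st'].
  have := mul (lam / mu * (s - c)) (t' - c); rewrite mulK.
  rewrite /rt; have [tc|ct] := leP t c; first by rewrite subrr mulr0; lra.
  by have := mul (t - c) (lam / mu * (s - c)); rewrite mulK; lra.
have mid_le : (\int[lebesgue_measure]_(s in `[b, c]) (f s)%:E
    <= (mu * Num.max (Num.min c t' - Num.max b t) 0)%:E)%E.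
  apply: integral_supported_le => //; first exact: ltW.
    move=> s /=; rewrite in_itv/= => sI; rewrite f0/=.
    rewrite (le_trans (fle s))// planned_share_mid// mulrC divfK// gt_eqF//.
  move=> s /=; rewrite in_itv/= => sI /fsupp.
  by rewrite planned_cross_mid// le_min ge_max; lra.
apply: le_trans (leeD (leeD left_le mid_le) right_le) _.
have -> : lam * Num.max (qt (Num.min b t') - qt t) 0
    = mu * Num.max (Num.min b t' - t) 0.
  rewrite !maxr_pMr ?(ltW lam0) ?(ltW capacity_gt0)// !mulr0; congr Num.max.
  by rewrite /qt; field; rewrite gt_eqF.
have -> : lam * Num.max (rt t' - rt (Num.max c t)) 0
    = mu * Num.max (t' - Num.max c t) 0.
  rewrite !maxr_pMr ?(ltW lam0) ?(ltW capacity_gt0)// !mulr0; congr Num.max.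
  by rewrite /rt; field; rewrite gt_eqF.
rewrite -!EFinD lee_fin -!mulrDr ler_pM2l//.
exact: sum_overlap_le.
Qed.

Lemma planned_feasible b c : t1 m <= b -> b <= c -> c <= t2 m ->
  feasible m (planned_profile b c).
Proof.
move=> t1b bc ct2; split.
- split; first exact: measurable_planned_share.
  exact: measurable_planned_cross.
- by move=> s _ /=; have /andP[/ltW-> ->] := planned_share_bounds b c s.
- by move=> s s' _ _; exact: planned_cross_le.
split=> //=.
- by move=> t t' tt'; exact: planned_flow_le.
- by move=> t t'; rewrite !subr0.
- by move=> t; rewrite ltxx.
Qed.

(** * The optimal toll and its equilibrium *)

Lemma early_peak_ge0 : 0 <= early_peak.
Proof.
have /andP[f0 f1] := fstar_bounds; apply: mulr_ge0.
  by apply: divr_ge0; [exact: ltW | rewrite addr_ge0 ?ltW].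
by rewrite mulr_ge0 ?subr_ge0// ltW.
Qed.

Lemma late_peak_ge0 : 0 <= late_peak.
Proof.
have /andP[f0 f1] := fstar_bounds; apply: mulr_ge0.
  by apply: divr_ge0; [exact: ltW | rewrite addr_ge0 ?ltW].
by rewrite mulr_ge0 ?subr_ge0// ltW.
Qed.

Lemma peakD : early_peak + late_peak = (1 - fstar m) * T.
Proof.
rewrite /early_peak /late_peak; field.
by rewrite gt_eqF// addr_gt0.
Qed.

Lemma early_late_peak : early m * early_peak = late m * late_peak.
Proof. by rewrite /early_peak /late_peak; ring. Qed.

(** A consequence of [peak_slack_ge0]: the toll falls by this amount from its plateau to either end
    of the crossing interval, so it stays nonnegative there. *)
Lemma peak_rent_le_gap : lam / mu * (early m * early_peak) <= gap.
Proof.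
have lam0 := lam_gt0; rewrite -(ler_pM2l lam0).
have -> : lam * (lam / mu * (early m * early_peak)) =
    lam ^+ 2 / mu * (early m * late m / (early m + late m))
      * ((1 - fstar m) * T).
  rewrite /early_peak; field.
  by rewrite !gt_eqF// addr_gt0.
have := peak_slack_ge0; rewrite /peak_slack.
have : 0 <= gap * mu by rewrite mulr_ge0 ?subr_ge0// ltW.
by lra.
Qed.

Definition optimal_b : R := t1 m + early_peak.

Definition optimal_c : R := t2 m - late_peak.

(** The truncation makes this a policy on the whole line; it is inactive on
    [[optimal_a, optimal_d]], by [optimal_toll_ge0]. *)
Definition optimal_toll (t : R) : R :=
  Num.max (peak_toll gap optimal_b optimal_c t) 0.

Lemma optimal_bc :
  [/\ t1 m <= optimal_b, optimal_b <= optimal_c & optimal_c <= t2 m].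
Proof.
rewrite /optimal_b /optimal_c; have := early_peak_ge0; have := late_peak_ge0.
have := peakD; have /andP[f0 _] := fstar_bounds.
have : 0 <= fstar m * T by rewrite mulr_ge0 ?subr_ge0// ltW.
by move=> *; split; lra.
Qed.

Lemma optimal_width : optimal_c - optimal_b = fstar m * T.
Proof. by rewrite /optimal_b /optimal_c; have := peakD; lra. Qed.

(** The discount [p - peak_toll] grows no faster than the early or late penalty, so moving from [s]
    to [t] never pays. *)
Lemma peak_toll_deviation p b c t s :
  p - peak_toll p b c t - deviation m t s <= p - peak_toll p b c s.
Proof.
rewrite /peak_toll /deviation.
have le_e : early m * Num.max (b - t) 0
    <= early m * Num.max (b - s) 0 + early m * Num.max (s - t) 0.
  rewrite -mulrDr ler_pM2l//.
  repeat match goal with |- context [Num.max ?x 0] => case: (leP x 0) => ? end;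
  lra.
have le_l : late m * Num.max (t - c) 0
    <= late m * Num.max (s - c) 0 + late m * Num.max (t - s) 0.
  rewrite -mulrDr ler_pM2l//.
  repeat match goal with |- context [Num.max ?x 0] => case: (leP x 0) => ? end;
  lra.
lra.
Qed.

(** The plan moves users only along the sloped parts, away from [[b, c]], where the gain in toll
    exactly offsets the penalty. *)
Lemma peak_toll_planned_cross p b c s : b <= c ->
  p - peak_toll p b c (planned_cross b c s)
    - deviation m (planned_cross b c s) s = p - peak_toll p b c s.
Proof.
move=> bc; have lam0 := lam_gt0.
have r1 : 0 < lam / mu - 1 by rewrite subr_gt0 ltr_pdivlMr// mul1r.
have [sb|bs] := leP s b.
  have : 0 <= (lam / mu - 1) * (b - s) by apply: mulr_ge0; lra.
  move=> shift; rewrite planned_cross_early// !peak_toll_early//; last by lra.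
  by rewrite deviation_early; [ring | lra].
have [sc|cs] := leP s c.
  have sI : b <= s <= c by rewrite (ltW bs).
  by rewrite planned_cross_mid// peak_toll_mid// deviation_early//; ring.
have : 0 <= (lam / mu - 1) * (s - c) by apply: mulr_ge0; lra.
move=> shift; rewrite planned_cross_late ?(ltW cs)// !peak_toll_late ?(ltW cs)//.
  by rewrite deviation_late; [ring | lra].
by lra.
Qed.

Lemma peak_toll_planned_ge0 s : t1 m <= s <= t2 m ->
  0 <= peak_toll gap optimal_b optimal_c (planned_cross optimal_b optimal_c s).
Proof.
case: optimal_bc => t1b bc ct2 /andP[s1 s2]; have lam0 := lam_gt0.
have gap0 : 0 <= gap by rewrite subr_ge0.
have rent := peak_rent_le_gap; have eL := early_late_peak.
have r0 : 0 < lam / mu by rewrite divr_gt0.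
have [sb|bs] := leP s optimal_b.
  have sh0 : 0 <= lam / mu * (optimal_b - s) by rewrite mulr_ge0 ?subr_ge0// ltW.
  rewrite planned_cross_early// peak_toll_early//; last by lra.
  suff : lam / mu * (early m * (optimal_b - s)) <= lam / mu * (early m * early_peak).
    by lra.
  by rewrite !ler_pM2l// /optimal_b; lra.
have [sc|cs] := leP s optimal_c.
  have sI : optimal_b <= s <= optimal_c by rewrite (ltW bs).
  by rewrite planned_cross_mid// peak_toll_mid.
have sh0 : 0 <= lam / mu * (s - optimal_c).
  by rewrite mulr_ge0 ?subr_ge0 ?(ltW cs)// ltW.
rewrite planned_cross_late ?(ltW cs)// peak_toll_late//; last by lra.
suff : lam / mu * (late m * (s - optimal_c)) <= lam / mu * (late m * late_peak).
  by rewrite -eL; lra.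
by rewrite !ler_pM2l// /optimal_c; lra.
Qed.

Lemma policy_optimal_toll : policy optimal_toll.
Proof.
split; last by move=> t; rewrite /optimal_toll le_max lexx orbT.
by apply: max_measurable; exact: measurable_peak_toll.
Qed.

Local Notation E0 := (planned_profile optimal_b optimal_c).

(** The two preceding comparisons show that planned crossings attain the best possible surplus. For
    users in [[optimal_b, optimal_c]] it is 0, so they are indifferent to transit and may split
    between the modes. *)
Lemma equilibrium_optimal_toll : equilibrium m optimal_toll E0.
Proof.
case: optimal_bc => t1b bc ct2.
have rent0 s : 0 <= gap - peak_toll gap optimal_b optimal_c s.
  rewrite /peak_toll.
  have : 0 <= early m * Num.max (optimal_b - s) 0.
    by rewrite mulr_ge0 ?(ltW early_gt0)// le_max lexx orbT.
  have : 0 <= late m * Num.max (s - optimal_c) 0.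
    by rewrite mulr_ge0 ?(ltW late_gt0)// le_max lexx orbT.
  by lra.
have V_le t s : surplus m optimal_toll (delay E0) t - deviation m t s
    <= gap - peak_toll gap optimal_b optimal_c s.
  have := peak_toll_deviation gap optimal_b optimal_c t s.
  have : peak_toll gap optimal_b optimal_c t <= optimal_toll t.
    by rewrite /optimal_toll le_max lexx.
  by rewrite /surplus /=; lra.
split; first exact: planned_feasible.
  move=> s [sI _].
  have VE : surplus m optimal_toll (delay E0) (cross E0 s)
      - deviation m (cross E0 s) s = gap - peak_toll gap optimal_b optimal_c s.
    rewrite -(peak_toll_planned_cross gap s bc) /surplus /= subr0 /optimal_toll.
    by rewrite max_l// peak_toll_planned_ge0.
  split; first by rewrite car_costE VE; have := rent0 s; lra.
  by move=> t; rewrite !car_costE VE; have := V_le t s; lra.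
move=> s sI share1 t; rewrite car_costE.
have [sbc|out] := boolP (optimal_b <= s <= optimal_c); last first.
  by move: share1; rewrite /= planned_share_out// ltxx.
by have := V_le t s; rewrite peak_toll_mid//; lra.
Qed.

Lemma planned_middle_mass : (\int[lebesgue_measure]_(s in `[optimal_b, optimal_c])
  (lam * share E0 s)%:E = (mu * (fstar m * T))%:E)%E.
Proof.
case: optimal_bc => _ bc _.
transitivity (\int[lebesgue_measure]_(s in `[optimal_b, optimal_c]) (cst mu%:E s))%E.
  apply: eq_integral => s; rewrite inE/= in_itv/= => sI.
  by rewrite planned_share_mid// mulrC divfK// gt_eqF// lam_gt0.
rewrite EFinM -optimal_width -(@lebesgue_measure_itv_le _ _ true false bc).
exact: integral_cst.
Qed.

Lemma planned_share_left s : t1 m <= s -> s < optimal_b -> share E0 s = 1.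
Proof. by move=> _ sb; rewrite /= planned_share_out// leNgt sb. Qed.

Lemma planned_share_right s : optimal_c < s -> s <= t2 m -> share E0 s = 1.
Proof. by move=> cs _; rewrite /= planned_share_out// (leNgt s) cs andbF. Qed.

Lemma collected_optimal_toll :
  collected m optimal_toll E0 = (optimal_revenue m)%:E.
Proof.
case: optimal_bc => t1b bc ct2.
have fE := planned_feasible t1b bc ct2.
have gap0 : 0 <= gap by rewrite subr_ge0.
rewrite optimal_revenueE.
have -> : profit gap early_peak late_peak (mu * (fstar m * T)) =
    profit gap (optimal_b - t1 m) (t2 m - optimal_c) (mu * (fstar m * T)).
  by rewrite /optimal_b /optimal_c (addrC (t1 m)) addrK subKr.
rewrite -(planned_revenue fE t1b bc ct2 gap0 planned_share_left
  planned_share_right planned_middle_mass); last first.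
  move=> s sI; rewrite mulr_ge0 ?peak_toll_planned_ge0//.
  exact: car_mass_ge0.
apply: eq_integral => s; rewrite inE/= in_itv/= => sI.
by rewrite /optimal_toll max_l// peak_toll_planned_ge0.
Qed.

Lemma revenue_optimal_toll : revenue m optimal_toll = (optimal_revenue m)%:E.
Proof.
apply/le_anti; rewrite revenue_le_optimal/=; last exact: policy_optimal_toll.
apply: ereal_sup_ubound; exists E0; last exact: collected_optimal_toll.
exact: equilibrium_optimal_toll.
Qed.

Lemma optimal_toll_optimal : revenue_optimal m optimal_toll.
Proof.
split; first exact: policy_optimal_toll.
by move=> toll' pol'; rewrite revenue_optimal_toll revenue_le_optimal.
Qed.

Lemma revenue_of_optimal toll : revenue_optimal m toll ->
  revenue m toll = (optimal_revenue m)%:E.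
Proof.
move=> [polT opt]; apply/le_anti; rewrite revenue_le_optimal//=.
by rewrite -revenue_optimal_toll opt//; exact: policy_optimal_toll.
Qed.

(** * Crossing interval and shape of the optimal toll *)

Definition optimal_a : R := optimal_b - lam / mu * early_peak.

Definition optimal_d : R := optimal_c + lam / mu * late_peak.

Lemma optimal_ad : optimal_a <= optimal_b /\ optimal_c <= optimal_d.
Proof.
have r0 : 0 <= lam / mu by rewrite divr_ge0 ?ltW// lam_gt0.
have : 0 <= lam / mu * early_peak by rewrite mulr_ge0// early_peak_ge0.
have : 0 <= lam / mu * late_peak by rewrite mulr_ge0// late_peak_ge0.
by rewrite /optimal_a /optimal_d => *; split; lra.
Qed.

Lemma planned_cross_t1 : planned_cross optimal_b optimal_c (t1 m) = optimal_a.
Proof.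
case: optimal_bc => t1b bc ct2; rewrite planned_cross_early//.
by rewrite /optimal_a /optimal_b (addrC (t1 m)) addrK.
Qed.

Lemma planned_cross_t2 : planned_cross optimal_b optimal_c (t2 m) = optimal_d.
Proof.
case: optimal_bc => t1b bc ct2; rewrite planned_cross_late//.
by rewrite /optimal_d /optimal_c subKr.
Qed.

Lemma planned_cross_bounds s : t1 m <= s <= t2 m ->
  optimal_a <= planned_cross optimal_b optimal_c s <= optimal_d.
Proof.
case: optimal_bc => t1b bc ct2 /andP[s1 s2].
by rewrite -planned_cross_t1 -planned_cross_t2 !planned_cross_le.
Qed.

Lemma optimal_mass : lam * (optimal_b - t1 m) + mu * (fstar m * T)
  + lam * (t2 m - optimal_c) = mu * (optimal_d - optimal_a).
Proof.
rewrite -optimal_width /optimal_d /optimal_a /optimal_b /optimal_c; field.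
by rewrite gt_eqF.
Qed.

Lemma crosses_over_optimal : crosses_over m E0 optimal_a optimal_d.
Proof.
case: optimal_bc optimal_ad => t1b bc ct2 [ab cd].
have fE := planned_feasible t1b bc ct2.
apply: crosses_over_of_mass => //; first by lra.
  by apply: aeW => s; rewrite /= in_itv/= => sI _; exact: planned_cross_bounds.
rewrite (total_car_mass fE t1b bc ct2 planned_share_left planned_share_right
  planned_middle_mass).
by rewrite optimal_mass.
Qed.

Lemma optimal_shapeP (D : set R) toll :
  (forall t, D t -> optimal_a <= t <= optimal_d ->
    toll t = peak_toll gap optimal_b optimal_c t) ->
  optimal_shape m D toll optimal_a optimal_b optimal_c optimal_d.
Proof.
move=> tollE; case: optimal_bc optimal_ad => t1b bc ct2 [ab cd].
split; first by [].
split.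
- by move=> t Dt tI; rewrite tollE ?peak_toll_mid//; lra.
- by rewrite optimal_width mulfK// gt_eqF// subr_gt0.
- by move=> t Dt tI; rewrite tollE ?peak_toll_early//; lra.
- by move=> t Dt tI; rewrite tollE ?peak_toll_late//; lra.
- rewrite /optimal_a /optimal_d /early_peak /late_peak massE.
  by split; field; rewrite !gt_eqF// addr_gt0.
Qed.

Lemma optimal_toll_ge0 t : optimal_a <= t <= optimal_d ->
  0 <= peak_toll gap optimal_b optimal_c t.
Proof.
case: optimal_bc => t1b bc ct2 /andP[a_t td].
have gap0 : 0 <= gap by rewrite subr_ge0.
have rent := peak_rent_le_gap; have eL := early_late_peak.
have [tb|bt] := leP t optimal_b.
  rewrite peak_toll_early//.
  suff : early m * (optimal_b - t) <= early m * (lam / mu * early_peak) by lra.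
  by rewrite ler_pM2l//; move: a_t; rewrite /optimal_a; lra.
have [tc|ct] := leP t optimal_c.
  by rewrite peak_toll_mid// (ltW bt).
rewrite peak_toll_late ?(ltW ct)//.
suff : late m * (t - optimal_c) <= late m * (lam / mu * late_peak).
  by move: rent; rewrite eL; lra.
by rewrite ler_pM2l//; move: td; rewrite /optimal_d; lra.
Qed.

(** * Uniqueness *)

Section Uniqueness.
Variables (toll : R -> R) (E : profile R).
Hypotheses (zC_lt_zT : zC m < zT m) (polT : policy toll)
  (eqE : equilibrium m toll E)
  (collectedE : collected m toll E = (optimal_revenue m)%:E).
Local Notation V := (surplus m toll (delay E)).

(** Attaining the bound annihilates every term of [optimal_revenue_sub_profit]: the squares fix [b]
    and [c], and the positive gap fixes [N]. Equal integrals of ordered integrands then agree almost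
    everywhere. *)
Lemma optimal_marginal_users : [/\ marginal_users m toll E 0 optimal_b optimal_c,
  (\int[lebesgue_measure]_(s in `[optimal_b, optimal_c]) (lam * share E s)%:E
   = (mu * (fstar m * T))%:E)%E &
  {ae lebesgue_measure, forall s, `[t1 m, t2 m]%classic s ->
    lam * share E s * toll (cross E s) = lam * share E s *
      peak_toll gap optimal_b optimal_c (planned_cross optimal_b optimal_c s)}].
Proof.
have gap0 : 0 < gap by rewrite subr_gt0.
have [u [b [c mrg]]] :=
  exists_marginal_users early_gt0 late_gt0 polT eqE (ltW t1_lt_t2) (ltW gap0).
have [N [N0 Nle massN planE le_profit]] := collected_le_profit polT eqE mrg.
have bounds := car_toll_bounds polT eqE mrg.
case: (mrg) => -[t1b bc ct2 u0 ugap] _; case: (eqE) => fE _ _.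
move: le_profit; rewrite collectedE lee_fin => opt_le.
have profitE : optimal_revenue m = profit (gap - u) (b - t1 m) (t2 m - c) N.
  by apply/le_anti; rewrite opt_le profit_le_optimal// N0.
have lam0 := lam_gt0; have T0 : 0 < T by rewrite subr_gt0.
have := optimal_revenue_sub_profit (b - t1 m) (t2 m - c) N.
rewrite profitE profitB.
have -> : T - (b - t1 m) - (t2 m - c) = c - b by ring.
have slack0 : 0 <= peak_slack * (c - b).
  by rewrite mulr_ge0 ?peak_slack_ge0 ?subr_ge0.
have mid0 : 0 <= gap * (mu * (c - b) - N) by rewrite mulr_ge0 ?subr_ge0// ltW.
have k0 : 0 < lam ^+ 2 / (2 * mu) by rewrite divr_gt0 ?exprn_gt0// mulr_gt0.
have ex0 : 0 <= lam ^+ 2 / (2 * mu) * (early m * (b - t1 m - early_peak) ^+ 2).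
  by apply: mulr_ge0; [exact: ltW | rewrite mulr_ge0 ?sqr_ge0 ?ltW].
have ly0 : 0 <= lam ^+ 2 / (2 * mu) * (late m * (t2 m - c - late_peak) ^+ 2).
  by apply: mulr_ge0; [exact: ltW | rewrite mulr_ge0 ?sqr_ge0 ?ltW].
have mass0 : 0 <= lam * (b - t1 m + (t2 m - c)) + N.
  by rewrite addr_ge0// mulr_ge0 ?(ltW lam0)//; lra.
have um0 : 0 <= u * (lam * (b - t1 m + (t2 m - c)) + N) by rewrite mulr_ge0.
rewrite mulrDr => diffE.
have sqr_eq k (v x y : R) : 0 < k -> 0 < v -> k * (v * (x - y) ^+ 2) = 0 -> x = y.
  move=> kp vp /eqP; rewrite mulf_eq0 gt_eqF//= mulf_eq0 gt_eqF//=.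
  by rewrite sqrf_eq0 subr_eq0 => /eqP.
have bE : b - t1 m = early_peak by apply: sqr_eq k0 early_gt0 _; lra.
have cE : t2 m - c = late_peak by apply: sqr_eq k0 late_gt0 _; lra.
have b_opt : b = optimal_b by rewrite /optimal_b -bE; ring.
have c_opt : c = optimal_c by rewrite /optimal_c -cE; ring.
have NE : N = mu * (c - b).
  have /eqP : gap * (mu * (c - b) - N) = 0 by lra.
  by rewrite mulf_eq0 gt_eqF//= subr_eq0 => /eqP.
(* With [N = mu * (c - b)] the mass of drivers is at least [mu * T > 0], so a positive [u] would
   cost revenue. *)
have uE : u = 0.
  have /eqP : u * (lam * (b - t1 m + (t2 m - c)) + N) = 0 by lra.
  rewrite mulf_eq0 => /orP[/eqP//|/eqP mass_eq0]; exfalso.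
  have : 0 <= (lam - mu) * (b - t1 m + (t2 m - c)).
    by apply: mulr_ge0; [rewrite subr_ge0 ltW | lra].
  have : 0 < mu * T by rewrite mulr_gt0.
  by move: mass_eq0; rewrite NE; lra.
move: mrg massN planE bounds; rewrite uE subr0 b_opt c_opt.
move=> mrg massN planE bounds.
split => //.
  by rewrite massN NE b_opt c_opt optimal_width.
apply: ae_eq_of_integral_eq => //.
- exact: measurable_collected.
- apply: measurable_funM; first exact: measurable_car_mass.
  apply: measurableT_comp; first exact: measurable_peak_toll.
  exact: measurable_planned_cross.
- by rewrite planE ltry.
- rewrite planE; move: collectedE; rewrite /collected => ->.
  by rewrite profitE uE subr0 b_opt c_opt.
Qed.

(** Once the toll equals its bound in [toll_le_peak_toll], the two other nonnegative terms there,
    delay and weighted distance to the plan, must vanish. *)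
Lemma ae_on_plan : {ae lebesgue_measure, forall s, `[t1 m, t2 m]%classic s ->
  0 < share E s -> [/\ cross E s = planned_cross optimal_b optimal_c s,
    delay E (cross E s) = 0 &
    toll (cross E s) = peak_toll gap optimal_b optimal_c (cross E s)]}.
Proof.
have [mrg _ onplan] := optimal_marginal_users.
apply: lebesgue_aeS onplan => s payE sI s0; have lam0 := lam_gt0.
have {}payE : toll (cross E s) =
    peak_toll gap optimal_b optimal_c (planned_cross optimal_b optimal_c s).
  by apply: (mulfI _ (payE sI)); rewrite gt_eqF// mulr_gt0.
have cs : car_user m E s by split => //; move: sI; rewrite /= in_itv.
have := toll_le_peak_toll eqE mrg cs; rewrite subr0 payE.
have w0 := equilibrium_delay_ge0 eqE (cross E s).
have min0 : 0 < Num.min (early m) (late m) by rewrite lt_min early_gt0.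
set k := Num.min _ _ in min0 *; set z := planned_cross _ _ _ => le_pay.
have kz0 : 0 <= k * `|z - cross E s| by rewrite mulr_ge0// ltW.
have crossE : cross E s = z.
  have /eqP : k * `|z - cross E s| = 0 by lra.
  by rewrite mulf_eq0 gt_eqF//= normr_eq0 subr_eq0 => /eqP.
by split; [exact: crossE | lra | rewrite crossE].
Qed.

(* A queue at [t] lasts from [t - delay E t] to [t] and discharges at capacity,
   hence delays a positive mass of users, contradicting [ae_on_plan]. *)
Lemma car_user_delay0 s : car_user m E s -> delay E (cross E s) = 0.
Proof.
move=> _; set t := cross E s; case: (eqE) => fE _ _.
case: (fE) => _ _ _ [cap w0 fifo discharge].
apply/le_anti; rewrite w0 andbT leNgt; apply/negP => wt.
have := discharge t wt; set t0 := t - delay E t => flowE.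
(* Almost every driver crossing in [[t0, t]] has no delay, so [fifo] puts its crossing at or before
   [t0], hence exactly at [t0]; but a single instant carries no flow. *)
have : (car_flow m E `[t0, t] <= car_flow m E `[t0, t0])%E.
  rewrite !car_flowE; apply: ae_ge0_le_integral => //.
  - move=> x; rewrite /= in_itv/= => xI; rewrite lee_fin mulr_ge0 ?indicE//.
    exact: car_mass_ge0.
  - by apply/measurable_EFinP; exact: measurable_car_mass_at.
  - move=> x; rewrite /= in_itv/= => xI; rewrite lee_fin mulr_ge0 ?indicE//.
    exact: car_mass_ge0.
  - by apply/measurable_EFinP; exact: measurable_car_mass_at.
  apply: lebesgue_aeS ae_on_plan => x plan xI; rewrite lee_fin.
  have xI' : t1 m <= x <= t2 m by move: xI; rewrite /= in_itv.
  have mass0 := car_mass_ge0 fE xI'.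
  have [x0|x0] := ltP 0 (share E x); last first.
    have -> : share E x = 0.
      by apply/le_anti; rewrite x0/=; case: fE => _ /(_ _ xI')/andP[].
    by rewrite mulr0 !mul0r.
  have [_ wx _] := plan xI x0.
  apply: ler_wpM2l => //; rewrite !indicE !mem_setE !in_itv/= ler_nat.
  have [/andP[t0x xt]|//] := boolP (t0 <= cross E x <= t).
  by have := fifo _ _ xt; rewrite wx subr0 t0x => ->.
move/le_trans/(_ (cap t0 t0 (lexx _))); rewrite flowE subrr mulr0 lee_fin leNgt.
by rewrite mulr_gt0.
Qed.

(** Upgrades [ae_on_plan] to every driver. With zero delay the toll is read off [V t], which on the
    slopes is squeezed between the bounds of [marginal_users]; the plateau needs a perturbation
    argument. *)
Lemma car_user_toll s : car_user m E s ->
  optimal_a <= cross E s <= optimal_d ->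
  toll (cross E s) = peak_toll gap optimal_b optimal_c (cross E s).
Proof.
move=> cs tI; have [mrg _ _] := optimal_marginal_users.
case: (mrg) => -[t1b bc ct2 _ _] [Vb Vc _ _ drv].
have w0 := car_user_delay0 cs; have Vge := drv _ cs.
have dev0 := deviation_ge0 early_gt0 late_gt0 (cross E s) s.
case: (cs) => /andP[s1 s2] _; set t := cross E s in w0 Vge dev0 tI *.
suff Vt : V t = gap - peak_toll gap optimal_b optimal_c t.
  by move: Vt; rewrite /surplus w0; lra.
have Vbt := Vb t; have Vct := Vc t.
have [tb|bt] := leP t optimal_b.
  rewrite peak_toll_early//; rewrite (deviation_early _ tb) in Vbt.
  have [sb|bs] := ltP s optimal_b.
    by have [] := early_users eqE mrg s1 sb; rewrite -/t; lra.
  have : early m * (optimal_b - t) <= early m * (s - t) by rewrite ler_pM2l//; lra.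
  by have := deviation_ge_early t s; lra.
have [ct|tc] := leP optimal_c t.
  rewrite peak_toll_late//; rewrite (deviation_late _ ct) in Vct.
  have [cs'|sc] := ltP optimal_c s.
    by have [] := late_users eqE mrg cs' s2; rewrite -/t; lra.
  have : late m * (t - optimal_c) <= late m * (t - s) by rewrite ler_pM2l//; lra.
  by have := deviation_ge_late t s; lra.
rewrite peak_toll_mid ?(ltW bt) ?(ltW tc)// subrr; apply/le_anti.
rewrite (le_trans _ Vge) ?add0r// andbT leNgt; apply/negP => Vt.
(* Users desired just after [t] would gain by crossing at [t], so they all drive,
   yet almost all of them cross on time and pay the full gap. *)
pose r := V t / (early m + late m).
have K0 : 0 < early m + late m by rewrite addr_gt0.
have r0 : 0 < r by rewrite divr_gt0.
(* For [x] in []t, q[] the penalty for crossing at [t] is below [V t], and the planned crossing of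
   [x] is on time. This interval has positive measure, so it cannot lie in the exceptional null
   set. *)
pose q := Num.min optimal_c (t + r).
have tq : t < q by rewrite /q lt_min tc ltrDl.
have : ~ {ae lebesgue_measure, forall x : R, ~ `]t, q[%classic x}.
  move=> [A [mA A0 subA]].
  have : (lebesgue_measure (`]t, q[%classic : set R) <= lebesgue_measure A)%E.
    apply: le_measure; rewrite ?inE//.
    by move=> x xI; apply: subA => /(_ xI).
  rewrite A0 lebesgue_measure_itv_le ?(ltW tq)// lee_fin leNgt.
  by rewrite subr_gt0 tq.
apply; apply: lebesgue_aeS ae_on_plan => x plan xI.
move: xI; rewrite /= in_itv/= => /andP[tx]; rewrite /q lt_min => /andP[xc xr].
have xI : t1 m <= x <= t2 m by lra.
have dev_lt : deviation m t x < V t.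
  rewrite (deviation_early _ (ltW tx)).
  have : x - t < r by lra.
  rewrite /r ltr_pdivlMr// => lt_r; apply: le_lt_trans lt_r.
  rewrite mulrC; apply: ler_wpM2l; first by rewrite subr_ge0 ltW.
  by rewrite lerDl ltW.
case: (eqE) => _ best stay.
have x0 : 0 < share E x.
  have /andP[x0 x1] : 0 <= share E x <= 1 by case: eqE => -[_ + _ _] _ _; exact.
  have [/(stay _ xI)/(_ t)|] := ltP (share E x) 1; last by lra.
  by rewrite car_costE; lra.
have cx : car_user m E x by [].
have [] := plan _ x0; first by rewrite /= in_itv.
have bx : optimal_b <= x <= optimal_c by lra.
rewrite planned_cross_mid// => -> wx; rewrite peak_toll_mid// => tollx.
have dev_x := deviation_ge0 early_gt0 late_gt0 x x.
have crossx : cross E x = x.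
  by have [|->] := plan _ x0; rewrite ?planned_cross_mid//= in_itv.
by have := best_cross eqE t cx; rewrite crossx {2}/surplus wx tollx; lra.
Qed.

Lemma total_mass_optimal :
  (\int[lebesgue_measure]_(s in `[t1 m, t2 m]) (lam * share E s)%:E
   = (mu * (optimal_d - optimal_a))%:E)%E.
Proof.
have [mrg massN _] := optimal_marginal_users; case: (eqE) => fE _ _.
case: mrg => -[t1b bc ct2 _ _] [_ _ left right _].
by rewrite (total_car_mass fE t1b bc ct2 left right massN) optimal_mass.
Qed.

Lemma crosses_over_unique : crosses_over m E optimal_a optimal_d.
Proof.
case: (eqE) => fE _ _; case: optimal_bc optimal_ad => t1b bc ct2 [ab cd].
apply: crosses_over_of_mass => //; [by lra | | exact: total_mass_optimal].
apply: lebesgue_aeS ae_on_plan => s plan sI s0.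
have [-> _ _] := plan sI s0; apply: planned_cross_bounds.
by move: sI; rewrite /= in_itv.
Qed.

Lemma optimal_shape_unique : optimal_shape m
  [set cross E s | s in [set s | car_user m E s]]
  toll optimal_a optimal_b optimal_c optimal_d.
Proof. by apply: optimal_shapeP => _ [s cs <-]; exact: car_user_toll. Qed.

End Uniqueness.

End Model.

Theorem theorem1 (R : realType) (m : bottleneck R)
    (mass_gt0 : 0 < mass m) (t1_lt_t2 : t1 m < t2 m)
    (capacity_gt0 : 0 < capacity m)
    (early_gt0 : 0 < early m) (early_lt1 : early m < 1) (late_gt0 : 0 < late m)
    (congested : capacity m < arrival_rate m) (zC_le_zT : zC m <= zT m) :
  [/\ (* a revenue-optimal policy of the announced shape exists *)
      exists (toll : R -> R) (E : profile R) (tA tB tC tD : R),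
        [/\ revenue_optimal m toll, induced_equilibrium m toll E,
            crosses_over m E tA tD &
            optimal_shape m [set: R] toll tA tB tC tD],
      (* every revenue-optimal policy has this shape at every time at which
         some car user crosses *)
      zC m < zT m ->
      forall (toll : R -> R) (E : profile R),
        revenue_optimal m toll -> induced_equilibrium m toll E ->
        exists tA tB tC tD : R,
          crosses_over m E tA tD
          /\ optimal_shape m [set cross E s | s in [set s | car_user m E s]]
               toll tA tB tC tD &
      forall toll : R -> R, revenue_optimal m toll ->
        revenue m toll = (optimal_revenue m)%:E].
Proof.
split.
- exists (optimal_toll m), (planned_profile m (optimal_b m) (optimal_c m)).
  exists (optimal_a m), (optimal_b m), (optimal_c m), (optimal_d m); split.
  + exact: optimal_toll_optimal.
  + split; first exact: equilibrium_optimal_toll.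
    by rewrite collected_optimal_toll// revenue_optimal_toll.
  + exact: crosses_over_optimal.
  + apply: optimal_shapeP => // t _ tI.
    by rewrite /optimal_toll max_l// optimal_toll_ge0.
- move=> zC_lt_zT toll E opt [eqE collE].
  have polT : policy toll by case: opt.
  have collectedE : collected m toll E = (optimal_revenue m)%:E.
    by rewrite collE revenue_of_optimal.
  exists (optimal_a m), (optimal_b m), (optimal_c m), (optimal_d m); split.
    by apply: (crosses_over_unique _ _ _ _ _ _ zC_lt_zT polT eqE collectedE).
  by apply: (optimal_shape_unique _ _ _ _ _ _ zC_lt_zT polT eqE collectedE).
- by move=> toll opt; exact: revenue_of_optimal.
Qed.
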